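(* For every $1 \leq p < \infty$ with $p \neq 2$, the Banach space $L_p \cap L_\infty$ (of functions on $(0,\infty)$ with Lebesgue measure) does not contain a complemented subspace isomorphic to $L_p$.
   Context: All functions are real-valued Lebesgue measurable functions, identified when equal almost everywhere; $L_p = L_p(0,\infty)$ and $L_\infty = L_\infty(0,\infty)$ with respect to Lebesgue measure (for $1\le p<\infty$, $L_p(0,\infty)$ is isometric to $L_p[0,1]$, so either may be meant by ''$L_p$''). The space $L_p \cap L_\infty$ consists of all functions on $(0,\infty)$ lying in both $L_p$ and $L_\infty$, with the norm $\|x\|_{L_p\cap L_\infty} = \max\{\|x\|_{L_p}, \|x\|_{L_\infty}\}$. A closed subspace of a Banach space $X$ is complemented if it is the range of a bounded linear projection on $X$. Isomorphic means linearly homeomorphic. *)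

(* Defs.v *)
From HB Require Import structures.
From mathcomp Require Import all_boot all_order all_algebra.
From mathcomp Require Import all_classical all_reals all_analysis.
From mathcomp Require Import measurable_realfun ess_sup_inf.

Set Implicit Arguments.
Unset Strict Implicit.
Unset Printing Implicit Defensive.
Import Order.TTheory GRing.Theory Num.Theory.
Import numFieldNormedType.Exports.
Local Open Scope classical_set_scope.
Local Open Scope ring_scope.

(* {mfun_ mu, T >-> measurableTypeR R}, the mathcomp-analysis type of classes of
   measurable real functions modulo mu-a.e. equality, comes without algebraic
   structure. We make it a vector space, then do the same, with their norms,
   for Lspace and for the intersection of L^p and L^oo. *)

Section L0.
Context d (T : measurableType d) (R : realType).
Variable mu : {measure set T -> \bar R}.

Local Notation L0 := {mfun_ mu, T >-> measurableTypeR R}.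
Local Open Scope quotient_scope.

(* [measurableTypeR R] and [R] carry the same Borel sigma-algebra but different
   displays, so {mfun T >-> R} cannot be used directly. *)
Definition mfunR (f : T -> R) (mf : measurable_fun setT f) :
    {mfun T >-> measurableTypeR R} :=
  HB.pack_for {mfun T >-> measurableTypeR R} (f : T -> measurableTypeR R)
    (@isMeasurableFun.Build _ _ T (measurableTypeR R) f mf).

Definition L0_class (f : T -> R) (mf : measurable_fun setT f) : L0 :=
  \pi_L0 (mfunR mf).

Lemma L0_measurable (f : L0) : measurable_fun setT (f : T -> R).
Proof. exact: (@measurable_funPT _ _ _ _ (repr f)). Qed.

Lemma L0_eqP (f g : L0) : f = g <-> ae_eq mu setT (f : T -> R) (g : T -> R).
Proof.
split=> [->|fg]; first exact: ae_eq_refl.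
by rewrite -[f]reprK -[g]reprK; apply/eqP; rewrite eqmodE; apply/asboolP.
Qed.

Lemma L0_classE (f : T -> R) (mf : measurable_fun setT f) :
  ae_eq mu setT (L0_class mf : T -> R) f.
Proof.
have /eqmodP/asboolP : repr (L0_class mf) = mfunR mf %[mod L0].
  by rewrite reprK.
by [].
Qed.

Let measurable_add (f g : L0) :
  measurable_fun setT ((f : T -> R) \+ (g : T -> R)).
Proof. by apply: measurable_funD; exact: L0_measurable. Qed.

Let measurable_opp (f : L0) : measurable_fun setT (\- (f : T -> R)).
Proof. by apply: measurableT_comp => //; exact: L0_measurable. Qed.

Let measurable_scale a (f : L0) : measurable_fun setT (a \*: (f : T -> R)).
Proof. by apply: measurable_funM => //; exact: L0_measurable. Qed.

Definition L0_zero : L0 := L0_class (measurable_cst (0 : R)).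
Definition L0_add (f g : L0) : L0 := L0_class (measurable_add f g).
Definition L0_opp (f : L0) : L0 := L0_class (measurable_opp f).
Definition L0_scale (a : R) (f : L0) : L0 := L0_class (measurable_scale a f).

Let zeroE : ae_eq mu setT (L0_zero : T -> R) (cst 0).
Proof. exact: L0_classE. Qed.

Let addE f g :
  ae_eq mu setT (L0_add f g : T -> R) ((f : T -> R) \+ (g : T -> R)).
Proof. exact: L0_classE. Qed.

Let oppE f : ae_eq mu setT (L0_opp f : T -> R) (\- (f : T -> R)).
Proof. exact: L0_classE. Qed.

Let scaleE a f : ae_eq mu setT (L0_scale a f : T -> R) (a \*: (f : T -> R)).
Proof. exact: L0_classE. Qed.

Let addA : associative L0_add.
Proof.
move=> f g h; apply/L0_eqP.
apply: filterS2 (filterI (addE f (L0_add g h)) (addE g h))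
  (filterI (addE (L0_add f g) h) (addE f g)).
move=> x [/(_ I) e1 /(_ I) e2] [/(_ I) e3 /(_ I) e4] _.
by rewrite e1 /= e2 e3 /= e4 /= addrA.
Qed.

Let addC : commutative L0_add.
Proof.
move=> f g; apply/L0_eqP; apply: filterS2 (addE f g) (addE g f).
by move=> x /(_ I) e1 /(_ I) e2 _; rewrite e1 e2 /= addrC.
Qed.

Let add0 : left_id L0_zero L0_add.
Proof.
move=> f; apply/L0_eqP; apply: filterS2 (addE L0_zero f) zeroE.
by move=> x /(_ I) e1 /(_ I) e2 _; rewrite e1 /= e2 /= add0r.
Qed.

Let addN : left_inverse L0_zero L0_opp L0_add.
Proof.
move=> f; apply/L0_eqP; apply: filterS3 (addE (L0_opp f) f) (oppE f) zeroE.
move=> x /(_ I) e1 /(_ I) e2 /(_ I) e3 _.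
by rewrite e1 /= e2 e3 /= addNr.
Qed.

HB.instance Definition _ := GRing.isZmodule.Build L0 addA addC add0 addN.

Let scaleA a b f : L0_scale a (L0_scale b f) = L0_scale (a * b) f.
Proof.
apply/L0_eqP.
apply: filterS3 (scaleE a (L0_scale b f)) (scaleE b f) (scaleE (a * b) f).
move=> x /(_ I) e1 /(_ I) e2 /(_ I) e3 _.
by rewrite e1 /= e2 e3 /= scalerA.
Qed.

Let scale1 : left_id 1 L0_scale.
Proof.
move=> f; apply/L0_eqP; apply: filterS (scaleE 1 f).
by move=> x /(_ I) e1 _; rewrite e1 /= scale1r.
Qed.

Let scaleDr : right_distributive L0_scale +%R.
Proof.
move=> a f g; apply/L0_eqP.
apply: filterS3 (filterI (scaleE a (L0_add f g)) (addE f g))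
  (addE (L0_scale a f) (L0_scale a g)) (filterI (scaleE a f) (scaleE a g)).
move=> x [/(_ I) e1 /(_ I) e2] /(_ I) e3 [/(_ I) e4 /(_ I) e5] _.
by rewrite e1 /= e2 e3 /= e4 e5 /= scalerDr.
Qed.

Let scaleDl f : {morph L0_scale^~ f : a b / a + b}.
Proof.
move=> a b; apply/L0_eqP.
apply: filterS3 (scaleE (a + b) f)
  (addE (L0_scale a f) (L0_scale b f)) (filterI (scaleE a f) (scaleE b f)).
move=> x /(_ I) e1 /(_ I) e3 [/(_ I) e4 /(_ I) e5] _.
by rewrite e1 /= e3 /= e4 e5 /= scalerDl.
Qed.

HB.instance Definition _ := GRing.Zmodule_isLmodule.Build R L0
  scaleA scale1 scaleDr scaleDl.

Lemma L0_0E : ae_eq mu setT ((0 : L0) : T -> R) (cst 0).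
Proof. exact: zeroE. Qed.

Lemma L0_addE (f g : L0) :
  ae_eq mu setT ((f + g : L0) : T -> R) ((f : T -> R) \+ (g : T -> R)).
Proof. exact: addE. Qed.

Lemma L0_oppE (f : L0) :
  ae_eq mu setT ((- f : L0) : T -> R) (\- (f : T -> R)).
Proof. exact: oppE. Qed.

Lemma L0_scaleE a (f : L0) :
  ae_eq mu setT ((a *: f : L0) : T -> R) (a \*: (f : T -> R)).
Proof. exact: scaleE. Qed.

End L0.

Section Lspace_normed.
Context d (T : measurableType d) (R : realType).
Variable mu : {measure set T -> \bar R}.
Variables (p : \bar R) (p1 : (1 <= p)%E).

Local Notation L0 := {mfun_ mu, T >-> measurableTypeR R}.
Local Notation N p f := ('N[mu]_p[EFin \o (f%R : T -> R)])%E.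

Lemma ae_eq_Lnorm (f g : T -> R) :
  measurable_fun setT f -> measurable_fun setT g ->
  ae_eq mu setT f g -> N p f = N p g.
Proof.
move=> mf mg fg; rewrite unlock /Lnorm; case: p p1 => [r r1|_|//].
  congr (_ `^ _)%E; apply: ge0_ae_eq_integral => //.
  - by apply: (measurableT_comp (measurable_poweR _)) => //;
      do 2! apply: measurableT_comp => //.
  - by apply: (measurableT_comp (measurable_poweR _)) => //;
      do 2! apply: measurableT_comp => //.
  - by move=> x _; exact: poweR_ge0.
  - by move=> x _; exact: poweR_ge0.
  - by apply: filterS fg => x /(_ I) /= ->.
case: ifPn => // _; apply: eq_ess_sup.
by apply: filterS fg => x /(_ I) /= ->.
Qed.

Definition finLspace : {pred L0} := [pred f : L0 | `[< finite_norm mu p f >]].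

Lemma L0_normD (f g : L0) : (N p (f + g : L0)%R <= N p f + N p g)%E.
Proof.
rewrite (ae_eq_Lnorm _ _ (L0_addE f g)).
- by apply: eminkowski => //; exact: L0_measurable.
- exact: L0_measurable.
- by apply: measurable_funD; exact: L0_measurable.
Qed.

Lemma L0_normZ a (f : L0) : f \in finLspace ->
  (N p (a *: f : L0)%R = `|a|%:E * N p f)%E.
Proof.
move=> /asboolP nf; rewrite (ae_eq_Lnorm _ _ (L0_scaleE a f)).
- have fL : (f : T -> R) \in Lfun mu p.
    by apply/andP; split; apply: mem_set => //; exact: L0_measurable.
  exact: (LnormZ (Lfun_Sub p1 fL)).
- exact: L0_measurable.
- by apply: measurable_funM => //; exact: L0_measurable.
Qed.

Lemma L0_norm0 : N p (0 : L0) = 0%E.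
Proof.
rewrite (ae_eq_Lnorm _ _ (L0_0E mu)).
- by rewrite Lnorm0// gt_eqF// (lt_le_trans _ p1).
- exact: L0_measurable.
- exact: measurable_cst.
Qed.

Lemma L0_norm_eq0 (f : L0) : N p f = 0%E -> f = 0.
Proof.
move=> f0; apply/L0_eqP.
have mf : measurable_fun setT (EFin \o (f : T -> R)).
  by apply/measurable_EFinP; exact: L0_measurable.
have := Lnorm_eq0_eq0 mf (lt_le_trans lte01 p1) f0.
move=> h; apply: filterS2 h (L0_0E mu).
by move=> x /(_ I) [e1] /(_ I) e2 _; rewrite e1 e2.
Qed.

Lemma finLspace_submod_closed : submod_closed finLspace.
Proof.
split=> [|a f g /= ff fg]; apply/asboolP; rewrite /finite_norm.
  by rewrite L0_norm0.
apply: (le_lt_trans (L0_normD _ _)); rewrite L0_normZ//.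
move/asboolP : ff => ff; move/asboolP : fg => fg.
by rewrite lte_add_pinfty// lte_mul_pinfty// lee_fin.
Qed.

HB.instance Definition _ := GRing.isSubmodClosed.Build _ _ finLspace
  finLspace_submod_closed.

Definition Lspace_Sub (f : L0) (ff : f \in finLspace) : LspaceType mu p1 :=
  HB.pack_for (LspaceType mu p1) f
    (@isFinLebesgue.Build _ _ _ mu p p1 f (asboolW ff)).

Lemma Lspace_rect (K : LspaceType mu p1 -> Type) :
  (forall f (ff : f \in finLspace), K (Lspace_Sub ff)) -> forall u, K u.
Proof.
move=> Ksub [f [[ff]]].
have ff' : f \in finLspace by exact/asboolP.
have -> : ff = asboolW ff' by exact: Prop_irrelevance.
exact: Ksub.
Qed.

Lemma Lspace_valP f (ff : f \in finLspace) : Lspace_Sub ff = f :> L0.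
Proof. by []. Qed.

HB.instance Definition _ :=
  isSub.Build _ _ (LspaceType mu p1) Lspace_rect Lspace_valP.
HB.instance Definition _ := [Choice of LspaceType mu p1 by <:].
HB.instance Definition _ := [SubChoice_isSubLmodule of LspaceType mu p1 by <:].

Lemma finLspace_fine (f : L0) : f \in finLspace -> (fine (N p f))%:E = N p f.
Proof.
move=> /asboolP ff.
by rewrite fineK// fin_numElt (lt_le_trans ltNy0) ?Lnorm_ge0.
Qed.

Lemma fine_L0_normD (f g : L0) : f \in finLspace -> g \in finLspace ->
  fine (N p (f + g : L0)) <= fine (N p f) + fine (N p g).
Proof.
move=> ff fg; rewrite -lee_fin EFinD !finLspace_fine ?rpredD//.
exact: L0_normD.
Qed.

Lemma fine_L0_normZ a (f : L0) : f \in finLspace ->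
  fine (N p (a *: f : L0)) = `|a| * fine (N p f).
Proof.
move=> ff; apply: EFin_inj.
by rewrite EFinM !finLspace_fine ?rpredZ// L0_normZ.
Qed.

Lemma fine_L0_norm_eq0 (f : L0) : f \in finLspace -> fine (N p f) = 0 -> f = 0.
Proof. by move=> ff f0; apply: L0_norm_eq0; rewrite -finLspace_fine// f0. Qed.

Definition Lspace_norm (f : LspaceType mu p1) : R := fine (N p f).

Let Lspace_normD f g : Lspace_norm (f + g) <= Lspace_norm f + Lspace_norm g.
Proof. exact: (fine_L0_normD (valP f) (valP g)). Qed.

Let Lspace_normZ a f : Lspace_norm (a *: f) = `|a| * Lspace_norm f.
Proof. exact: (fine_L0_normZ a (valP f)). Qed.

Let Lspace_norm_eq0 f : Lspace_norm f = 0 -> f = 0.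
Proof. by move=> f0; apply: val_inj; exact: (fine_L0_norm_eq0 (valP f)). Qed.

HB.instance Definition _ := Lmodule_isNormed.Build R (LspaceType mu p1)
  Lspace_normD Lspace_normZ Lspace_norm_eq0.

Lemma Lspace_normE (f : LspaceType mu p1) : `|f| = fine (N p f).
Proof. by []. Qed.

End Lspace_normed.

Arguments finLspace {d T R} mu p.
Arguments finLspace_submod_closed {d T R} mu {p}.

Section Lcap.
Context d (T : measurableType d) (R : realType).
Variable mu : {measure set T -> \bar R}.
Variables (p : \bar R) (p1 : (1 <= p)%E).

Local Notation L0 := {mfun_ mu, T >-> measurableTypeR R}.
Local Notation N p f := ('N[mu]_p[EFin \o (f%R : T -> R)])%E.

Let y1 : (1 <= +oo :> \bar R)%E. Proof. exact: leey. Qed.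

Definition finLcap : {pred L0} :=
  [predI finLspace mu p & finLspace mu +oo%E].

(* The phantom parameter [p1] mirrors LspaceType: the vector space and norm
   structures are only available when 1 <= p. *)
Record LcapLinfty (p1 : (1 <= p)%E) := MkLcapLinfty {
  Lcap_val :> L0;
  Lcap_finite : Lcap_val \in finLcap
}.

HB.instance Definition _ := [isSub for @Lcap_val p1].
HB.instance Definition _ := [Choice of LcapLinfty p1 by <:].

Let finLcap_submod_closed : submod_closed finLcap.
Proof.
have [p0 pD] := finLspace_submod_closed mu p1.
have [q0 qD] := finLspace_submod_closed mu y1.
split=> [|a f g /andP[fp fq] /andP[gp gq]]; apply/andP; split => //.
  exact: pD.
exact: qD.
Qed.

HB.instance Definition _ := GRing.isSubmodClosed.Build _ _ finLcap
  finLcap_submod_closed.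

HB.instance Definition _ := [SubChoice_isSubLmodule of LcapLinfty p1 by <:].

Definition Lcap_norm (f : LcapLinfty p1) : R :=
  Num.max (fine (N p f)) (fine (N +oo f)).

Let Lcap_normD f g : Lcap_norm (f + g) <= Lcap_norm f + Lcap_norm g.
Proof.
have /andP[fp fy] := valP f; have /andP[gp gy] := valP g.
rewrite ge_max; apply/andP; split.
- apply: (le_trans (fine_L0_normD p1 fp gp)).
  by apply: lerD; rewrite le_max lexx.
- apply: (le_trans (fine_L0_normD y1 fy gy)).
  by apply: lerD; rewrite le_max lexx orbT.
Qed.

Let Lcap_normZ a f : Lcap_norm (a *: f) = `|a| * Lcap_norm f.
Proof.
have /andP[fp fy] := valP f.
by rewrite /Lcap_norm maxr_pMr// -(fine_L0_normZ p1)// -(fine_L0_normZ y1).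
Qed.

Let Lcap_norm_eq0 f : Lcap_norm f = 0 -> f = 0.
Proof.
have /andP[fp fy] := valP f.
move=> f0; apply: val_inj; apply: (fine_L0_norm_eq0 p1 fp).
apply/eqP; rewrite eq_le; apply/andP; split.
  by rewrite -f0 le_max lexx.
by rewrite fine_ge0// Lnorm_ge0.
Qed.

HB.instance Definition _ := Lmodule_isNormed.Build R (LcapLinfty p1)
  Lcap_normD Lcap_normZ Lcap_norm_eq0.

Lemma Lcap_normE (f : LcapLinfty p1) :
  `|f| = Num.max (fine (N p f)) (fine (N +oo f)).
Proof. by []. Qed.

End Lcap.

Arguments LcapLinfty {d T R} mu {p} p1.

Section complemented.
Context (R : realType).

Definition closed_subspace (X : normedModType R) (Y : set X) : Prop :=
  submod_closed (mem Y) /\ closed Y.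

Definition bounded_projection (X : normedModType R) (P : {linear X -> X}) :
    Prop :=
  idempotent_fun P /\ exists C : R, forall x, `|P x| <= C * `|x|.

Definition complemented (X : normedModType R) (Y : set X) : Prop :=
  closed_subspace Y /\
  exists2 P : {linear X -> X}, bounded_projection P & range P = Y.

(* [V] is the inverse of the linear bijection [U : W -> Y]; its values outside
   of [Y] are irrelevant. *)
Definition isomorphic_to_subspace (W X : normedModType R) (Y : set X) : Prop :=
  exists (U : {linear W -> X}) (V : X -> W),
    [/\ continuous U, range U = Y, cancel U V & {within Y, continuous V}].

Definition contains_complemented_copy (X W : normedModType R) : Prop :=
  exists Y : set X, complemented Y /\ isomorphic_to_subspace W Y.

End complemented.

Section half_line.
Context (R : realType).

Lemma Lebesgue_measurable_half_line :
  ((wlength (@idfun R))^*)%mu.-cara.-measurable `]0%R, +oo[%classic.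
Proof.
apply: sub_caratheodory.
exact: (measurable_itv `]0%R, +oo[).
Qed.

(* Lebesgue measure on (0, +oo), as the measure A |-> lambda (A `&` (0, +oo)) on
   the Lebesgue measurable subsets of R. Functions are thus defined on all of R
   but are identified as soon as they agree a.e. on (0, +oo), and their norms
   only depend on their values there. *)
Definition half_line_measure :=
  mrestr (@completed_lebesgue_measure R) Lebesgue_measurable_half_line.

HB.instance Definition _ := Measure.on half_line_measure.

End half_line.

Arguments half_line_measure R : clear implicits.

(* Main.v *)
Require Import Defs.
From HB Require Import structures.
From mathcomp Require Import all_boot all_order all_algebra.
From mathcomp Require Import all_classical all_reals all_analysis.
From mathcomp Require Import measurable_realfun ess_sup_inf.
From mathcomp Require Import ring lra.

Set Implicit Arguments.
Unset Strict Implicit.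
Unset Printing Implicit Defensive.
Import Order.TTheory GRing.Theory Num.Theory.
Import numFieldNormedType.Exports.
Local Open Scope ring_scope.

(** Suppose that L^p were isomorphic to a complemented subspace of the
    intersection of L^p and L^oo. The inverse isomorphism composed with the
    projection gives bounded linear maps U from L^p to the intersection and S
    back with S (U f) = f (factorization_of_complemented_copy). The contradiction
    comes from testing them on the Rademacher functions r_n on D = [0, 1[, with
    x_n = U r_n, and from measuring the values of S by their integrals over D,
    that is, in L^1(D).

    The heart of the matter is that S nearly forgets x_n on any set A of finite
    measure: some n makes S (x_n 1_A) small in L^1(D) (small_on_finite). On
    functions supported in A the norm of the intersection is equivalent to the
    supremum norm, so that S acts there as an operator from L^oo to L^1, and
    Grothendieck's inequality bounds the square function of the S (x_n 1_A) by the
    supremum of that of the x_n (sqfun_bound, which only needs operators defined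
    on finitely many atoms). Now for every finite p and every delta > 0,
    sums of the a_n r_n over n < N have norm at most delta sqrt N times the
    Euclidean norm of a as soon as N is large (norm_rad_sum_le); taking for
    a_n the value of x_n at a point shows that the sum of the |x_n|^2 is o(N)
    pointwise, hence so is the sum of the L^1 norms of the S (x_n 1_A).

    A function of the intersection is small, for both norms, off a suitable set
    of finite measure (tail_set). Alternating the two facts gives disjoint sets B_k
    such that the pieces y_k = x_(n_k) 1_(B_k) satisfy S y_k close to r_(n_k)
    (pieces_exist). Take M of them. By Khinchine's inequality signed sums of the
    r_(n_k) have L^1 norm at least sqrt M / 2 on average, while, the pieces being
    disjoint, signed sums of the y_k have norm the maximum of the l^p norm of the
    norms of the y_k in L^p and of a constant (pieces_lower). If p > 2, this
    maximum is O(M^(1/p)), which is too small. If p < 2, averaging over the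
    signs shows that among N pieces the p-th powers of the L^p norms add up to
    at most O(N^(p/2)) = o(N) (pieces_average), because this bounds them by the
    p-th powers of signed sums of x_n, hence of r_n; so M of the pieces have
    a bounded l^p sum, and M was arbitrary. *)
(** * Sign averages *)

Definition cons_sign (b : bool) (e : nat -> bool) : nat -> bool :=
  fun k => if k is k'.+1 then e k' else b.

(** Sign patterns are listed rather than drawn at random, a sum over [signs n]
    being 2 ^ n times the corresponding expectation; they are infinite sequences,
    of which only the first n terms matter, so that recursion on n is by
    [cons_sign]. *)
Fixpoint signs (n : nat) : seq (nat -> bool) :=
  if n is n'.+1 then map (cons_sign false) (signs n') ++ map (cons_sign true) (signs n')
  else [:: fun=> false].

Lemma size_signs n : size (signs n) = (2 ^ n)%N.
Proof. by elim: n => //= n IH; rewrite size_cat !size_map IH addnn expnS mul2n. Qed.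

Section scalar.
Variable R : realType.
Implicit Types (a : nat -> R) (p : R).

Lemma sum_signs_cst n (c : R) : \sum_(e <- signs n) c = 2 ^+ n * c.
Proof.
by rewrite big_const_seq count_predT size_signs iter_addr_0 -[LHS]mulr_natl natrX.
Qed.

Lemma sum_signsS n (F : (nat -> bool) -> R) :
  \sum_(e <- signs n.+1) F e =
  \sum_(e <- signs n) (F (cons_sign false e) + F (cons_sign true e)).
Proof. by rewrite /= big_cat !big_map big_split. Qed.

Definition signed_sum n a (e : nat -> bool) : R := \sum_(k < n) (-1) ^+ e k * a k.

Lemma signed_sumS n a b e :
  signed_sum n.+1 a (cons_sign b e) =
  (-1) ^+ b * a 0%N + signed_sum n (fun k => a k.+1) e.
Proof. by rewrite /signed_sum big_ord_recl. Qed.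

Lemma signed_sum_cons n a e :
  (signed_sum n.+1 a (cons_sign false e) = a 0%N + signed_sum n (fun k => a k.+1) e) *
  (signed_sum n.+1 a (cons_sign true e) = - a 0%N + signed_sum n (fun k => a k.+1) e).
Proof. by rewrite !signed_sumS /= expr0 expr1 mul1r mulN1r. Qed.

Lemma signed_sum_moment2 n a :
  \sum_(e <- signs n) signed_sum n a e ^+ 2 = 2 ^+ n * \sum_(k < n) a k ^+ 2.
Proof.
elim: n a => [|n IH] a.
  by rewrite /= big_seq1 /signed_sum !big_ord0 expr0n mulr0.
rewrite sum_signsS.
have E (u v : R) : (u + v) ^+ 2 + (- u + v) ^+ 2 = 2 * u ^+ 2 + 2 * v ^+ 2.
  by ring.
under eq_bigr do rewrite !signed_sum_cons E.
rewrite big_split /= sum_signs_cst -mulr_sumr IH big_ord_recl (exprS 2 n).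
by rewrite (eq_bigr (fun k : 'I_n => a k.+1 ^+ 2)) //; ring.
Qed.

Lemma signed_sum_moment4 n a :
  \sum_(e <- signs n) signed_sum n a e ^+ 4 <=
  2 ^+ n * (3 * (\sum_(k < n) a k ^+ 2) ^+ 2).
Proof.
elim: n a => [|n IH] a.
  by rewrite /= big_seq1 /signed_sum !big_ord0 !expr0n /= !mulr0.
rewrite sum_signsS.
have E (u v : R) : (u + v) ^+ 4 + (- u + v) ^+ 4 =
    2 * u ^+ 4 + (12 * u ^+ 2 * v ^+ 2 + 2 * v ^+ 4) by ring.
under eq_bigr do rewrite !signed_sum_cons E.
rewrite !big_split /= sum_signs_cst -!mulr_sumr signed_sum_moment2.
rewrite big_ord_recl (exprS 2 n).
rewrite (eq_bigr (fun k : 'I_n => a k.+1 ^+ 2)) //.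
have := IH (fun k => a k.+1).
set s := \sum_(k < n) _; set q := \sum_(e <- _) _; set N := 2 ^+ n => qs.
have N0 : 0 <= N by rewrite exprn_ge0.
have -> : 2 * N * (3 * (a 0%N ^+ 2 + s) ^+ 2) = N * (2 * a 0%N ^+ 4) +
   (12 * a 0%N ^+ 2 * (N * s) + 2 * (N * (3 * s ^+ 2))) + 4 * (N * a 0%N ^+ 4).
  by ring.
have : 0 <= 4 * (N * a 0%N ^+ 4).
  by do 2! apply: mulr_ge0 => //; exact: exprn_even_ge0.
lra.
Qed.

(** The second and fourth moments control the first one: u >= u ^ 2 - u ^ 4 / 6 for
    u >= 0, applied to u = |sum| / s, has mean at least 1 - 3 / 6. *)
Lemma khinchine_L1 n a :
  2 ^+ n * Num.sqrt (\sum_(k < n) a k ^+ 2) <=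
  2 * \sum_(e <- signs n) `|signed_sum n a e|.
Proof.
set s2 := \sum_(k < n) _; set s := Num.sqrt s2.
have s20 : 0 <= s2 by apply: sumr_ge0 => k _; exact: sqr_ge0.
have ss : s ^+ 2 = s2 by rewrite sqr_sqrtr.
have [s0|s0] := leP s 0.
  apply: (@le_trans _ _ 0); first by rewrite mulr_ge0_le0 ?exprn_ge0.
  by rewrite mulr_ge0 ?sumr_ge0.
rewrite -(ler_pM2l (exprn_gt0 3 s0)).
have pt (u : R) : 0 <= u -> u ^+ 2 * s ^+ 2 - u ^+ 4 / 6 <= u * s ^+ 3.
  move=> u0; rewrite -subr_ge0.
  have -> : u * s ^+ 3 - (u ^+ 2 * s ^+ 2 - u ^+ 4 / 6) =
    u * (s ^+ 3 - u * s ^+ 2 + u ^+ 3 / 6) by field.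
  apply: mulr_ge0 => //.
  (* The tangent to u ^ 3 at u = 10 / 7 s leaves two positive remainders. *)
  have -> : s ^+ 3 - u * s ^+ 2 + u ^+ 3 / 6 =
    ((u - 10 / 7 * s) ^+ 2 * (u + 20 / 7 * s)) / 6 + s ^+ 2 * (u * (3 / 147)) +
    s ^+ 3 * (58 / 2058) by field.
  have s0' := ltW s0.
  apply: addr_ge0; first apply: addr_ge0.
  - apply: mulr_ge0; last by lra.
    apply: mulr_ge0; first exact: sqr_ge0.
    by apply: addr_ge0 => //; apply: mulr_ge0 => //; lra.
  - apply: mulr_ge0; first exact: sqr_ge0.
    by apply: mulr_ge0 => //; lra.
  - by apply: mulr_ge0; [exact: exprn_ge0|lra].
have : \sum_(e <- signs n) (signed_sum n a e ^+ 2 * s ^+ 2 -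
    signed_sum n a e ^+ 4 / 6) <=
   \sum_(e <- signs n) `|signed_sum n a e| * s ^+ 3.
  apply: ler_sum => e _; have := pt _ (normr_ge0 (signed_sum n a e)).
  by rewrite real_normK ?num_real// -[4%N]/(2 * 2)%N !exprM real_normK ?num_real.
rewrite sumrB -!mulr_suml signed_sum_moment2 -/s2.
have := signed_sum_moment4 n a; rewrite -/s2.
rewrite -ss; set q := \sum_(e <- _) _; set r := \sum_(e <- _) _.
set N := 2 ^+ n => h1 h2.
have -> : s ^+ 3 * (N * s) = N * s ^+ 4 by ring.
have e1 : N * (3 * (s ^+ 2) ^+ 2) = 3 * (N * s ^+ 4) by ring.
have e2 : N * s ^+ 2 * s ^+ 2 = N * s ^+ 4 by ring.
rewrite e1 in h1; rewrite e2 in h2.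
have -> : s ^+ 3 * (2 * r) = 2 * (r * s ^+ 3) by ring.
lra.
Qed.

Lemma powR_midpoint p (u v : R) : 1 <= p ->
  2 * `|u| `^ p <= `|u + v| `^ p + `|u - v| `^ p.
Proof.
move=> p1.
have h : `|u| <= 2^-1 * `|u + v| + 2^-1 * `|u - v|.
  rewrite -mulrDr ler_pdivlMl// -[2 * `|u|]ger0_norm ?mulr_ge0// normrM normr_id.
  rewrite -normrM [2 * u](_ : _ = (u + v) + (u - v)); last by ring.
  exact: ler_normD.
have h2 : (2^-1 * `|u + v| + 2^-1 * `|u - v|) `^ p <=
    2^-1 * `|u + v| `^ p + 2^-1 * `|u - v| `^ p.
  rewrite {2 4}(_ : 2^-1 = 1 - 2^-1 :> R); last by lra.
  by apply: (convex_powR p1 (Itv01 _ _)) => //=;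
    rewrite ?inE/= ?in_itv/= ?normr_ge0// ?invr_ge0// invf_le1 ?ler1n.
rewrite -ler_pdivlMl// mulrDr.
apply: le_trans h2; by rewrite ge0_ler_powR ?nnegrE ?(le_trans _ p1)// addr_ge0// mulr_ge0.
Qed.

(** By convexity, averaging over the signs of the other terms can only decrease
    the p-th power. *)
Lemma le_powR_signed_sum n a k p : (k < n)%N -> 1 <= p ->
  2 ^+ n * `|a k| `^ p <= \sum_(e <- signs n) `|signed_sum n a e| `^ p.
Proof.
move=> kn p1; elim: n a k kn => // n IH a [|k] kn; rewrite sum_signsS.
  apply: (@le_trans _ _ (\sum_(e <- signs n) 2 * `|a 0%N| `^ p)).
    by rewrite sum_signs_cst mulrA exprSr.
  apply: ler_sum => e _; rewrite !signed_sum_cons.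
  by rewrite [- _ + _]addrC distrC; exact: powR_midpoint.
apply: (@le_trans _ _ (\sum_(e <- signs n)
    2 * `|signed_sum n (fun k => a k.+1) e| `^ p)).
  by rewrite -mulr_sumr exprS -mulrA ler_pM2l// IH.
apply: ler_sum => e _; rewrite !signed_sum_cons.
rewrite [a 0%N + _]addrC [- _ + _]addrC.
exact: powR_midpoint.
Qed.

Lemma sqr_sum_le (I : Type) (r : seq I) (F : I -> R) :
  (\sum_(i <- r) F i) ^+ 2 <= (size r)%:R * \sum_(i <- r) F i ^+ 2.
Proof.
elim: r => [|i r IH]; first by rewrite !big_nil expr0n mulr0.
rewrite !big_cons /=; set s := \sum_(i <- r) _ in IH *.
set q := \sum_(i <- r) _ in IH *; set n := size r in IH *.
have h : 2 * s * F i <= q + n%:R * F i ^+ 2.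
  have [n0|n0] := eqVneq n 0%N.
    by rewrite /s /q (size0nil n0) n0 !big_nil mulr0 !mul0r addr0.
  have n0' : 0 < n%:R :> R by rewrite ltr0n lt0n.
  rewrite -(ler_pM2l n0') mulrDr; apply: le_trans (lerD IH (lexx _)).
  rewrite -subr_ge0 [X in 0 <= X](_ : _ = (s - n%:R * F i) ^+ 2) ?sqr_ge0//.
  by ring.
rewrite -natr1 mulrDl mulrDr mul1r sqrrD -mulr_natl mulrA.
lra.
Qed.

Lemma sum_norm_le (I : Type) (r : seq I) (F : I -> R) :
  \sum_(i <- r) `|F i| <=
  Num.sqrt (size r)%:R * Num.sqrt (\sum_(i <- r) F i ^+ 2).
Proof.
rewrite -sqrtrM// -[X in X <= _]ger0_norm ?sumr_ge0// -sqrtr_sqr ler_sqrt.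
  apply: le_trans (sqr_sum_le r (fun i => `|F i|)) _.
  by apply/ler_wpM2l/ler_sum => // i _; rewrite real_normK ?num_real.
by rewrite mulr_ge0// sumr_ge0// => i _; rewrite sqr_ge0.
Qed.

Definition clip2 (x : R) := Num.max (-2) (Num.min x 2).

Lemma clip2_le x : `|clip2 x| <= 2.
Proof.
rewrite /clip2; case: (leP x 2) => h1; case: (leP (-2) _) => h2;
  rewrite ler_norml; lra.
Qed.

(** The excess |x| - 2 is at most x ^ 2 / 8, as (|x| - 4) ^ 2 >= 0; hence clipping a
    sum of mean square 1 and fourth moment at most 3 discards a function of
    mean square at most 3 / 64. *)
Lemma clip2_rest x : `|x - clip2 x| <= x ^+ 2 / 8.
Proof.
have h y : 0 <= (y - 4) ^+ 2 :> R := sqr_ge0 _.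
rewrite /clip2; case: (leP x 2) => h1; case: (leP (-2) _) => h2;
  rewrite ler_norml; have := h x; have := h (-x); rewrite !expr2; nra.
Qed.

Lemma powR_le_1sqr p (u : R) : 0 <= p -> p <= 2 -> 0 <= u ->
  u `^ p <= 1 + u ^+ 2.
Proof.
move=> p0 p2 u0; have [u1|u1] := leP u 1.
  apply: (@le_trans _ _ 1); last by rewrite lerDl sqr_ge0.
  rewrite (_ : 1 = 1 `^ p); last by rewrite powR1.
  by rewrite ge0_ler_powR ?nnegrE.
apply: (@le_trans _ _ (u `^ 2%:R)); first by rewrite ler_powR// ltW.
by rewrite powR_mulrn// lerDr.
Qed.

(** After integration over a set of measure 1, this bounds the L^1 norm by twice any
    positive bound c of the L^p norm. *)
Lemma le_scaled_powR p (c u : R) : 1 <= p -> 0 < c -> 0 <= u ->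
  u <= c + c / (c `^ p) * u `^ p.
Proof.
move=> p1 c0 u0; have cp : 0 < c `^ p by rewrite powR_gt0.
have [uc|cu] := leP u c.
  rewrite (le_trans uc)// lerDl mulr_ge0 ?powR_ge0// divr_ge0 ?powR_ge0//.
  exact: ltW.
have h : u / c <= u `^ p / c `^ p.
  have -> : u `^ p / c `^ p = (u / c) `^ p.
    rewrite powRM ?invr_ge0 ?(ltW c0)//; congr (_ * _).
    by rewrite -[in RHS]powR_inv1 ?(ltW c0)// -powRrM mulN1r powRN.
  by apply: le1r_powR => //; rewrite ler_pdivlMr// mul1r ltW.
rewrite -mulrA [_^-1 * _]mulrC; apply: (@le_trans _ _ (c * (u / c))).
  by rewrite mulrC divfK// gt_eqF.
apply: (@le_trans _ _ (c * (u `^ p / c `^ p))); first by rewrite ler_pM2l.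
by rewrite lerDr ltW.
Qed.

End scalar.

(** * A Grothendieck inequality for operators into L1 *)

Section integral_real.
Local Open Scope classical_set_scope.
Local Open Scope ring_scope.
Context d (T : measurableType d) (R : realType).
Variables (mu : {measure set T -> \bar R}) (D : set T).
Hypothesis mD : measurable D.
Implicit Types f g : T -> R.

Lemma le_integral_real f g : measurable_fun setT f -> measurable_fun setT g ->
  (forall t, D t -> 0 <= f t <= g t) ->
  (\int[mu]_(t in D) (f t)%:E <= \int[mu]_(t in D) (g t)%:E)%E.
Proof.
move=> mf mg fg; apply: ge0_le_integral => //.
- by move=> t /fg /andP[f0 _]; rewrite lee_fin.
- by apply/measurable_EFinP; exact: measurable_funTS.
- by apply/measurable_EFinP; exact: measurable_funTS.
- by move=> t /fg /andP[_ h]; rewrite lee_fin.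
Qed.

Lemma integral_realD f g : measurable_fun setT f -> measurable_fun setT g ->
  (forall t, D t -> 0 <= f t) -> (forall t, D t -> 0 <= g t) ->
  (\int[mu]_(t in D) (f t + g t)%:E =
   \int[mu]_(t in D) (f t)%:E + \int[mu]_(t in D) (g t)%:E)%E.
Proof.
move=> mf mg f0 g0; under eq_integral do rewrite EFinD.
by rewrite ge0_integralD//; apply/measurable_EFinP; exact: measurable_funTS.
Qed.

Lemma integral_realZ c f : measurable_fun setT f ->
  (forall t, D t -> 0 <= f t) -> 0 <= c ->
  (\int[mu]_(t in D) (c * f t)%:E = c%:E * \int[mu]_(t in D) (f t)%:E)%E.
Proof.
move=> mf f0 c0; under eq_integral do rewrite EFinM.
by rewrite ge0_integralZl_EFin//; apply/measurable_EFinP; exact: measurable_funTS.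
Qed.

Lemma integral_real_sum (I : Type) (r : seq I) (f : I -> T -> R) :
  (forall i, measurable_fun setT (f i)) -> (forall i t, D t -> 0 <= f i t) ->
  (\int[mu]_(t in D) (\sum_(i <- r) f i t)%:E =
   \sum_(i <- r) \int[mu]_(t in D) (f i t)%:E)%E.
Proof.
move=> mf f0; under eq_integral do rewrite -sumEFin.
rewrite ge0_integral_sum// => i; apply/measurable_EFinP; exact: measurable_funTS.
Qed.

Lemma integral_real_sum_le (I : Type) (r : seq I) (f : I -> T -> R) (c : R) :
  (forall i, measurable_fun setT (f i)) -> (forall i t, D t -> 0 <= f i t) ->
  (forall i, (\int[mu]_(t in D) (f i t)%:E <= c%:E)%E) ->
  (\int[mu]_(t in D) (\sum_(i <- r) f i t)%:E <= ((size r)%:R * c)%:E)%E.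
Proof.
move=> mf f0 fc; rewrite integral_real_sum//.
elim: r => [|i r IH]; first by rewrite big_nil mul0r.
rewrite big_cons /= -natr1 mulrDl mul1r addrC EFinD leeD//.
Qed.

Lemma integral_restrT (f : T -> R) : measurable_fun setT f ->
  (forall t, ~ D t -> f t = 0) ->
  (\int[mu]_t (f t)%:E = \int[mu]_(t in D) (f t)%:E)%E.
Proof.
move=> mf fD; rewrite [RHS]integral_mkcond; apply: eq_integral => t _.
by rewrite patchE; case: ifPn => // /negP; rewrite inE => /fD ->.
Qed.

End integral_real.

Lemma measurable_sqrtr (R : realType) : measurable_fun [set: R] (@Num.sqrt R).
Proof. by apply: continuous_measurable_fun; exact: sqrt_continuous. Qed.

Lemma size_index_enum (I : finType) : size (index_enum I) = #|I|.
Proof. by rewrite -sum1_size -sum1_card; apply: eq_bigl. Qed.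

Section square_function.
Local Open Scope classical_set_scope.
Local Open Scope ring_scope.
Context d (T : measurableType d) (R : realType).
Variables (mu : {measure set T -> \bar R}) (D : set T).
Hypothesis mD : measurable D.
Variables (I : finType) (g : I -> T -> R).
Hypothesis mg : forall i, measurable_fun setT (g i).

(** The operator that maps the i-th unit vector to [g i], from the bounded functions
    on the finite set [I] to the functions on [T]; [L] below bounds it as
    an operator from the supremum norm to L^1. *)
Definition lincomb (v : I -> R) (t : T) : R := \sum_i v i * g i t.

Definition sqfun (s : seq (I -> R)) (t : T) : R :=
  Num.sqrt (\sum_(v <- s) lincomb v t ^+ 2).

Lemma measurable_lincomb v : measurable_fun setT (lincomb v).
Proof.
apply: measurable_sum => i; apply: measurable_funM => //.
Qed.

Lemma measurable_sqfun s : measurable_fun setT (sqfun s).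
Proof.
apply: measurableT_comp; first exact: measurable_sqrtr.
by apply: measurable_sum => v; apply: measurable_funX; exact: measurable_lincomb.
Qed.

Lemma lincombZ c v t : lincomb (fun i => c * v i) t = c * lincomb v t.
Proof. by rewrite /lincomb mulr_sumr; apply: eq_bigr => i _; rewrite mulrA. Qed.

Lemma lincombD u v t :
  lincomb (fun i => u i + v i) t = lincomb u t + lincomb v t.
Proof. by rewrite /lincomb -big_split; apply: eq_bigr => i _; rewrite mulrDl. Qed.

Variable L : R.
Hypothesis lincombL : forall v, (forall i, `|v i| <= 1) ->
  (\int[mu]_(t in D) `|lincomb v t|%:E <= L%:E)%E.

Lemma lincomb_bound_ge0 : 0 <= L.
Proof.
rewrite -lee_fin; apply: le_trans (lincombL (v := fun=> 0) _).
  by apply: integral_ge0 => t _; rewrite lee_fin.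
by move=> i; rewrite normr0.
Qed.

Let mnorm v : measurable_fun setT (fun t => `|lincomb v t|).
Proof. by apply: measurableT_comp => //; exact: measurable_lincomb. Qed.

Definition unit_family (s : seq (I -> R)) :=
  forall i, \sum_(v <- s) v i ^+ 2 <= 1.

(** The set [I] being finite, there is some uniform bound, though it depends on the
    size of [I]; it starts the iteration of [sqfun_improve]. *)
Lemma sqfun_crude : exists K, forall s, unit_family s ->
  (\int[mu]_(t in D) (sqfun s t)%:E <= K%:E)%E.
Proof.
pose m : R := #|I|%:R; exists (m * (m * L)) => s us.
pose G t := \sum_i `|g i t|.
have gE i t : g i t = lincomb (fun j => (j == i)%:R) t.
  rewrite /lincomb (bigD1 i)//= eqxx mul1r big1 ?addr0// => j /negPf ->.
  by rewrite mul0r.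
have mgn i : measurable_fun setT (fun t => `|g i t|) by exact: measurableT_comp.
have mG : measurable_fun setT G by exact: measurable_sum.
have G0 t : 0 <= G t by apply: sumr_ge0.
have m0 : 0 <= m by [].
apply: (@le_trans _ _ (\int[mu]_(t in D) (m * G t)%:E)%E).
  apply: le_integral_real => //; first exact: measurable_sqfun.
    by apply: measurable_funM.
  move=> t _; rewrite sqrtr_ge0 /= /sqfun.
  rewrite -[leRHS]ger0_norm ?mulr_ge0// -sqrtr_sqr ler_sqrt ?sqr_ge0//.
  have h v : lincomb v t ^+ 2 <= (m * \sum_i v i ^+ 2) * G t ^+ 2.
    apply: (@le_trans _ _ ((\sum_i `|v i|) ^+ 2 * G t ^+ 2)).
      rewrite -exprMn -real_normK ?num_real// lerXn2r ?nnegrE ?mulr_ge0 ?sumr_ge0//.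
      rewrite (le_trans (ler_norm_sum _ _ _))// mulr_suml ler_sum// => i _.
      rewrite normrM ler_wpM2l// /G (bigD1 i)//= lerDl sumr_ge0//.
    rewrite ler_wpM2r ?sqr_ge0//.
    rewrite (le_trans (sqr_sum_le _ (fun i => `|v i|)))//.
    rewrite size_index_enum.
    by rewrite ler_wpM2l// ler_sum// => i _; rewrite real_normK ?num_real.
  apply: (@le_trans _ _ (\sum_(v <- s) (m * \sum_i v i ^+ 2) * G t ^+ 2)).
    exact: ler_sum.
  rewrite -mulr_suml -mulr_sumr exprMn ler_wpM2r ?sqr_ge0// ler_wpM2l//.
  rewrite exchange_big /=; apply: le_trans (ler_sum _ (fun i _ => us i)) _.
  by rewrite sumr_const.
rewrite integral_realZ// EFinM lee_wpmul2l//.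
have := @integral_real_sum_le _ _ _ mu D mD I (index_enum I) (fun i t => `|g i t|) L.
rewrite size_index_enum; apply=> // i.
rewrite (_ : (fun _ => _) = (fun t => `|lincomb (fun j => (j == i)%:R) t|%:E)).
  by apply: lincombL => j; case: eqP => _; rewrite ?normr1 ?normr0.
by apply/funext => t; rewrite gE.
Qed.

(** By Khinchine's inequality, the square function of a family is dominated by
    twice the mean of |T G|, for T the operator [lincomb] and G the signed sums of
    the family. Clipped pointwise at 2, the sums G contribute at most 4 L. What
    was clipped off, indexed by the signs, is after multiplication by
    c = 4 / sqrt (2 ^ n) again a unit family, and the Cauchy-Schwarz inequality over
    the signs bounds its contribution by half of the square function of the
    latter. *)
Lemma sqfun_improve K :
  (forall s, unit_family s -> (\int[mu]_(t in D) (sqfun s t)%:E <= K%:E)%E) ->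
  (forall s, unit_family s ->
     (\int[mu]_(t in D) (sqfun s t)%:E <= (4 * L + K / 2)%:E)%E).
Proof.
move=> HK s us; pose n := size s; pose v k := nth (fun=> 0) s k.
pose N : R := 2 ^+ n.
have N0 : 0 < N by rewrite exprn_gt0.
pose G e i := signed_sum n (fun k => v k i) e.
pose c : R := 4 / Num.sqrt N.
have sN0 : 0 < Num.sqrt N by rewrite sqrtr_gt0.
have c0 : 0 < c by rewrite divr_gt0.
have c2 : c ^+ 2 = 16 / N.
  rewrite /c expr_div_n sqr_sqrtr ?ltW//; congr (_ / _); ring.
pose w e i := c * (G e i - clip2 (G e i)).
have sumv (F : (I -> R) -> R) : \sum_(u <- s) F u = \sum_(k < n) F (v k).
  by rewrite (big_nth (fun=> 0)) big_mkord.
have uw : unit_family [seq w e | e <- signs n].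
  move=> i; rewrite big_map.
  apply: (@le_trans _ _ (\sum_(e <- signs n) c ^+ 2 / 64 * (G e i) ^+ 4)).
    apply: ler_sum => e _; rewrite exprMn -mulrA ler_wpM2l ?sqr_ge0//.
    have -> : 64^-1 * G e i ^+ 4 = (G e i ^+ 2 / 8) ^+ 2 by field.
    rewrite -real_normK ?num_real// lerXn2r ?nnegrE ?clip2_rest//.
    by rewrite divr_ge0 ?sqr_ge0.
  rewrite -mulr_sumr.
  apply: (@le_trans _ _ (c ^+ 2 / 64 * (N * 3))).
    rewrite ler_wpM2l ?divr_ge0 ?sqr_ge0//.
    apply: le_trans (signed_sum_moment4 _ _) _.
    rewrite ler_pM2l// ler_piMr// -(expr1n _ 2) lerXn2r ?nnegrE//.
      by apply: sumr_ge0 => k _; exact: sqr_ge0.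
    by rewrite -(sumv (fun u => u i ^+ 2)); exact: us.
  rewrite c2 [leLHS](_ : _ = 3 / 4); first by lra.
  by field; rewrite gt_eqF.
have linG e t : lincomb (G e) t = signed_sum n (fun k => lincomb (v k) t) e.
  rewrite /lincomb /signed_sum /G; under eq_bigr do rewrite mulr_suml.
  rewrite exchange_big /=; apply: eq_bigr => k _; rewrite mulr_sumr.
  by apply: eq_bigr => i _; rewrite mulrA.
pose H e t := `|lincomb (fun i => clip2 (G e i)) t|.
have pt t : sqfun s t <= 2 / N * (\sum_(e <- signs n) H e t) +
    2^-1 * sqfun [seq w e | e <- signs n] t.
  have := khinchine_L1 n (fun k => lincomb (v k) t).
  rewrite -(sumv (fun u => lincomb u t ^+ 2)) -/(sqfun s t) -/N => h.
  rewrite -(ler_pM2l N0) (le_trans h)//.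
  have h2 : \sum_(e <- signs n) `|signed_sum n (fun k => lincomb (v k) t) e| <=
     \sum_(e <- signs n) H e t + c^-1 * \sum_(e <- signs n) `|lincomb (w e) t|.
    rewrite mulr_sumr -big_split ler_sum// => e _.
    rewrite -linG /H.
    have -> : lincomb (G e) t =
        lincomb (fun i => clip2 (G e i)) t + c^-1 * lincomb (w e) t.
      rewrite -lincombZ -lincombD; congr (lincomb _ t); apply/funext => i.
      by rewrite /w mulrA mulVf ?gt_eqF// mul1r subrKC.
    by rewrite (le_trans (ler_normD _ _))// lerD2l normrM ger0_norm// invr_ge0 ltW.
  have h3 := sum_norm_le (signs n) (fun e => lincomb (w e) t).
  rewrite size_signs natrX -/N in h3.
  have -> : N * (2 / N * (\sum_(e <- signs n) H e t) +
    2^-1 * sqfun [seq w e | e <- signs n] t) = 2 * (\sum_(e <- signs n) H e t +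
    c^-1 * (Num.sqrt N * sqfun [seq w e | e <- signs n] t)).
    have -> : c^-1 = Num.sqrt N / 4 by rewrite /c invf_div.
    have gen (M q X Y : R) : q != 0 -> M = q ^+ 2 ->
        M * (2 / M * X + 2^-1 * Y) = 2 * (X + q / 4 * (q * Y)).
      by move=> q0 ->; field.
    by apply: gen; rewrite ?gt_eqF// sqr_sqrtr// ltW.
  rewrite ler_pM2l// (le_trans h2)// lerD2l ler_wpM2l//.
    by rewrite invr_ge0 ltW.
  by rewrite /sqfun big_map.
have mH e : measurable_fun setT (H e) by exact: mnorm.
have H0 t : 0 <= \sum_(e <- signs n) H e t.
  by apply: sumr_ge0 => e _; exact: normr_ge0.
have mS : measurable_fun setT (fun t => \sum_(e <- signs n) H e t).
  exact: measurable_sum.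
have mQ := measurable_sqfun [seq w e | e <- signs n].
have c1 : 0 <= 2 / N by rewrite divr_ge0 ?ltW.
apply: le_trans (le_integral_real _ _ _ _ _) _; [by []|
  exact: measurable_sqfun| |by move=> t _; rewrite sqrtr_ge0 /=; exact: pt|].
  by apply: measurable_funD; apply: measurable_funM.
rewrite integral_realD//; last 4 first.
- exact: measurable_funM.
- exact: measurable_funM.
- by move=> t _; rewrite mulr_ge0.
- by move=> t _; rewrite mulr_ge0 ?invr_ge0 ?sqrtr_ge0.
rewrite EFinD leeD//; last first.
  rewrite integral_realZ ?invr_ge0//; last by move=> t _; rewrite sqrtr_ge0.
  by rewrite mulrC EFinM lee_wpmul2l ?lee_fin ?invr_ge0// HK.
rewrite integral_realZ//.
have -> : 4 * L = 2 / N * (N * (2 * L)) by field; rewrite gt_eqF.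
rewrite [leRHS]EFinM lee_wpmul2l ?lee_fin//.
have := @integral_real_sum_le _ _ _ mu D mD _ (signs n) H (2 * L).
rewrite size_signs natrX; apply=> // [e t _|e]; first exact: normr_ge0.
pose u i := 2^-1 * clip2 (G e i).
rewrite (_ : (fun _ => _) = (fun t => (2 * `|lincomb u t|)%:E)); last first.
  apply/funext => t; rewrite /H /u lincombZ normrM mulrA ger0_norm ?invr_ge0//.
  by rewrite mulfV// mul1r.
rewrite integral_realZ// EFinM lee_wpmul2l// lincombL// => i.
by rewrite /u normrM ger0_norm ?invr_ge0// ler_pdivrMl// mulr1 clip2_le.
Qed.

(** The fixed point of K |-> 4 L + K / 2, reached from an arbitrary finite bound. *)
Lemma sqfun_bound s : unit_family s ->
  (\int[mu]_(t in D) (sqfun s t)%:E <= (8 * L)%:E)%E.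
Proof.
have [K0 HK0] := sqfun_crude.
have HK j s' : unit_family s' ->
    (\int[mu]_(t in D) (sqfun s' t)%:E <= (8 * L + K0 / 2 ^+ j)%:E)%E.
  elim: j s' => [|j IH] s' us'.
    apply: le_trans (HK0 _ us') _; rewrite lee_fin expr0 divr1 lerDr.
    by rewrite mulr_ge0 ?lincomb_bound_ge0.
  apply: le_trans (sqfun_improve IH us') _; rewrite lee_fin exprS.
  rewrite invfM mulrCA; set y := K0 / _; lra.
move=> us; apply/lee_addgt0Pr => e e0.
pose j := Num.bound (`|K0| / e).
have hj : K0 / 2 ^+ j <= e.
  have := archi_boundP (divr_ge0 (normr_ge0 K0) (ltW e0)); rewrite -/j => hj.
  rewrite ler_pdivrMr ?exprn_gt0// mulrC -ler_pdivrMr//.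
  apply: (@le_trans _ _ (`|K0| / e)).
    by rewrite ler_pM2r ?invr_gt0// ler_norm.
  by rewrite (le_trans (ltW hj))// -natrX ler_nat ltnW// ltn_expl.
by apply: le_trans (HK j s us) _; rewrite -EFinD lee_fin lerD2l.
Qed.

Lemma sqfun_bound_scaled s (b : R) : 0 < b ->
  (forall i, \sum_(v <- s) v i ^+ 2 <= b ^+ 2) ->
  (\int[mu]_(t in D) (sqfun s t)%:E <= (8 * L * b)%:E)%E.
Proof.
move=> b0 sb; pose s' := [seq (fun i => b^-1 * v i) | v : I -> R <- s].
have us' : unit_family s'.
  move=> i; rewrite big_map; under eq_bigr do rewrite exprMn.
  by rewrite -mulr_sumr exprVn ler_pdivrMl ?exprn_gt0// mulr1.
have E t : sqfun s t = b * sqfun s' t.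
  rewrite /sqfun big_map; under [in RHS]eq_bigr do rewrite lincombZ exprMn.
  rewrite -mulr_sumr sqrtrM ?sqr_ge0// sqrtr_sqr ger0_norm ?invr_ge0 ?ltW//.
  by rewrite mulrA mulfV ?gt_eqF// mul1r.
under eq_integral do rewrite E.
rewrite integral_realZ ?(ltW b0)//; last by move=> t _; rewrite sqrtr_ge0.
  rewrite [_ * b]mulrC [leRHS]EFinM lee_wpmul2l ?lee_fin ?(ltW b0)//.
  exact: sqfun_bound.
exact: measurable_sqfun.
Qed.

End square_function.

(** * Representatives of classes in L^p and in the intersection *)

Section spaces.
Local Open Scope classical_set_scope.
Local Open Scope ring_scope.
Context d (T : measurableType d) (R : realType).
Variables (mu : {measure set T -> \bar R}) (p : R) (p1 : (1 <= p%:E)%E).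
Local Notation L0 := {mfun_ mu, T >-> measurableTypeR R}.
Local Notation X := (LcapLinfty mu p1).
Local Notation Z := (LspaceType mu p1).

(** The p-th power of the L^p norm, which adds up over disjoint supports. *)
Definition pint (f : T -> R) : \bar R := (\int[mu]_t (`|f t| `^ p)%:E)%E.

Let p1' : 1 <= p. Proof. by rewrite -lee_fin. Qed.
Let p0 : 0 < p. Proof. exact: lt_le_trans p1'. Qed.

Lemma measurable_normp (f : T -> R) : measurable_fun setT f ->
  measurable_fun setT (fun t => `|f t| `^ p).
Proof.
move=> mf; apply: (@measurableT_comp _ _ _ _ _ _ (@powR R ^~ p)) => //.
exact: measurableT_comp.
Qed.

Lemma pint_ge0 f : (0 <= pint f)%E.
Proof. by apply: integral_ge0 => t _; rewrite lee_fin powR_ge0. Qed.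

Lemma Lnorm_pint (f : T -> R) :
  ('N[mu]_(p%:E) [EFin \o f] = pint f `^ p^-1)%E.
Proof.
by rewrite unlock /Lnorm /pint; congr (_ `^ _)%E; apply: eq_integral => t _.
Qed.

Lemma ae_pint (f g : T -> R) : measurable_fun setT f -> measurable_fun setT g ->
  (\forall t \ae mu, f t = g t) -> pint f = pint g.
Proof.
move=> mf mg fg; apply: ge0_ae_eq_integral => //.
- by apply/measurable_EFinP; exact: measurable_normp.
- by apply/measurable_EFinP; exact: measurable_normp.
- by apply: filterS fg => t ->.
Qed.

Lemma pint_fin_num (f : T -> R) : finite_norm mu p%:E f -> pint f \is a fin_num.
Proof.
rewrite /finite_norm Lnorm_pint => h.
rewrite ge0_fin_numE ?pint_ge0// ltey; apply/eqP => e.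
by move: h; rewrite e poweRyr ?gt_eqF ?invr_gt0// ltxx.
Qed.

Lemma fine_Lnorm_pint (f : T -> R) : finite_norm mu p%:E f ->
  pint f = ((fine ('N[mu]_(p%:E) [EFin \o f])) `^ p)%:E.
Proof.
move=> /pint_fin_num fin; rewrite Lnorm_pint -(fineK fin) poweR_EFin /=.
by rewrite -powRrM mulVf ?gt_eqF// powRr1// fine_ge0// pint_ge0.
Qed.

Lemma pint_lty_finite_norm (f : T -> R) : (pint f < +oo)%E ->
  finite_norm mu p%:E f.
Proof. by move=> h; rewrite /finite_norm Lnorm_pint poweR_lty. Qed.

Lemma Lspace_pint (f : Z) : pint (f : L0) = (`|f| `^ p)%:E.
Proof. by rewrite fine_Lnorm_pint//; apply/asboolP; exact: (valP f). Qed.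

Lemma Lspace_norm_le (f : Z) c : 0 <= c -> (pint (f : L0) <= (c `^ p)%:E)%E ->
  `|f| <= c.
Proof.
move=> c0; rewrite Lspace_pint lee_fin => h.
rewrite leNgt; apply/negP => cf; move: h; apply/negP; rewrite -ltNge.
by apply: gt0_ltr_powR; rewrite ?nnegrE.
Qed.

Lemma Lspace_exists (g : T -> R) : measurable_fun setT g -> (pint g < +oo)%E ->
  exists f : Z, \forall t \ae mu, (f : L0) t = g t.
Proof.
move=> mg gy; have gE := L0_classE mu mg.
have ff : L0_class mu mg \in finLspace mu p%:E.
  apply/asboolP; apply: pint_lty_finite_norm.
  rewrite (@ae_pint _ g)//; first exact: L0_measurable.
  by apply: filterS gE => t /(_ I).
exists (Lspace_Sub p1 ff); apply: filterS gE => t /(_ I); exact.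
Qed.

Lemma Lcap_pint_le (x : X) : (pint (x : L0) <= (`|x| `^ p)%:E)%E.
Proof.
have /andP[xp _] := valP x.
rewrite fine_Lnorm_pint; last exact/asboolP.
rewrite lee_fin; apply: ge0_ler_powR; rewrite ?nnegrE ?(ltW p0)//.
  by rewrite fine_ge0// Lnorm_ge0.
by rewrite Lcap_normE le_max lexx.
Qed.

Lemma L0_lincombE (I : Type) (r : seq I) (a : I -> R) (h : I -> L0) :
  \forall t \ae mu, (\sum_(i <- r) a i *: h i : L0) t =
                    \sum_(i <- r) a i * (h i : T -> R) t.
Proof.
elim: r => [|i r IH].
  rewrite big_nil; apply: filterS (L0_0E mu) => t /(_ Logic.I) ->.
  by rewrite big_nil.
rewrite big_cons.
apply: filterS3 IH (L0_addE (a i *: h i) (\sum_(j <- r) a j *: h j))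
  (L0_scaleE (a i) (h i)).
by move=> t IH /(_ Logic.I) + /(_ Logic.I) e; rewrite big_cons /= e IH.
Qed.

Lemma Lspace_lincombE (I : Type) (r : seq I) (a : I -> R) (h : I -> Z) :
  \forall t \ae mu, ((\sum_(i <- r) a i *: h i : Z) : L0) t =
                    \sum_(i <- r) a i * (h i : L0) t.
Proof.
have -> : (\sum_(i <- r) a i *: h i : Z) = \sum_(i <- r) a i *: (h i : L0) :> L0.
  elim: r => [|i r IH]; first by rewrite !big_nil.
  by rewrite !big_cons -IH.
exact: L0_lincombE.
Qed.

Lemma Lcap_lincombE (I : Type) (r : seq I) (a : I -> R) (h : I -> X) :
  \forall t \ae mu, ((\sum_(i <- r) a i *: h i : X) : L0) t =
                    \sum_(i <- r) a i * (h i : L0) t.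
Proof.
have -> : (\sum_(i <- r) a i *: h i : X) = \sum_(i <- r) a i *: (h i : L0) :> L0.
  elim: r => [|i r IH]; first by rewrite !big_nil.
  by rewrite !big_cons -IH.
exact: L0_lincombE.
Qed.

Lemma Lcap_subE (x y : X) :
  \forall t \ae mu, ((x - y : X) : L0) t = (x : L0) t - (y : L0) t.
Proof.
apply: filterS2 (L0_addE (x : L0) (- (y : L0))) (L0_oppE (y : L0)).
by move=> t /(_ Logic.I) + /(_ Logic.I) e; rewrite /= e.
Qed.

Lemma Lspace_subE (x y : Z) :
  \forall t \ae mu, ((x - y : Z) : L0) t = (x : L0) t - (y : L0) t.
Proof.
apply: filterS2 (L0_addE (x : L0) (- (y : L0))) (L0_oppE (y : L0)).
by move=> t /(_ Logic.I) + /(_ Logic.I) e; rewrite /= e.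
Qed.

Lemma Lcap_eqP (x y : X) : (\forall t \ae mu, (x : L0) t = (y : L0) t) -> x = y.
Proof.
move=> xy; apply: val_inj; apply/L0_eqP.
by apply: filterS xy => t ->.
Qed.

Lemma le_pint (f g : T -> R) : measurable_fun setT f -> measurable_fun setT g ->
  (\forall t \ae mu, `|f t| <= `|g t|) -> (pint f <= pint g)%E.
Proof.
move=> mf mg fg; apply: ae_ge0_le_integral => //.
- by apply/measurable_EFinP; exact: measurable_normp.
- by apply/measurable_EFinP; exact: measurable_normp.
- apply: filterS fg => t fg _.
  by rewrite lee_fin; apply: ge0_ler_powR; rewrite ?nnegrE ?(ltW p0).
Qed.

Hypothesis mu0 : (0 < mu setT)%E.

Lemma Lcap_ae_le (x : X) : \forall t \ae mu, `|(x : L0) t| <= `|x|.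
Proof.
have /andP[_ xy] := valP x.
have := ess_sup_ge mu (abse \o (EFin \o ((x : L0) : T -> R))).
have E : 'N[mu]_+oo%E[EFin \o ((x : L0) : T -> R)]%E =
    ess_sup mu (abse \o (EFin \o ((x : L0) : T -> R))).
  by rewrite unlock /Lnorm mu0.
rewrite -E -finLspace_fine//; apply: filterS => t /=.
by rewrite lee_fin => /le_trans; apply; rewrite Lcap_normE le_max lexx orbT.
Qed.

Lemma Linfty_le (g : T -> R) c : (\forall t \ae mu, `|g t| <= c) ->
  ('N[mu]_+oo [EFin \o g] <= c%:E)%E.
Proof.
move=> gc; rewrite unlock /Lnorm mu0; apply/ess_supP.
by apply: filterS gc => t /=; rewrite lee_fin.
Qed.

Lemma Lcap_norm_le (x : X) c : 0 <= c -> (pint (x : L0) <= (c `^ p)%:E)%E ->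
  (\forall t \ae mu, `|(x : L0) t| <= c) -> `|x| <= c.
Proof.
move=> c0 xc xy; have /andP[xp xi] := valP x.
rewrite Lcap_normE ge_max; apply/andP; split; last first.
  by rewrite -lee_fin finLspace_fine//; exact: Linfty_le.
rewrite fine_Lnorm_pint in xc; last exact/asboolP.
rewrite leNgt; apply/negP => cf; move: xc; apply/negP; rewrite -ltNge lte_fin.
by apply: gt0_ltr_powR; rewrite ?nnegrE// fine_ge0// Lnorm_ge0.
Qed.

Lemma Lcap_exists (g : T -> R) c : measurable_fun setT g -> (pint g < +oo)%E ->
  (\forall t \ae mu, `|g t| <= c) ->
  exists x : X, \forall t \ae mu, (x : L0) t = g t.
Proof.
move=> mg gy gc; have gE := L0_classE mu mg.
have ff : L0_class mu mg \in @finLcap _ _ _ mu p%:E.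
  apply/andP; split; apply/asboolP.
    apply: pint_lty_finite_norm.
    rewrite (@ae_pint _ g)//; first exact: L0_measurable.
    by apply: filterS gE => t /(_ I).
  rewrite /finite_norm; apply: (@le_lt_trans _ _ c%:E); last exact: ltry.
  by apply: Linfty_le; apply: filterS2 gE gc => t /(_ I) ->.
exists (MkLcapLinfty p1 ff); apply: filterS gE => t /(_ I); exact.
Qed.

Lemma Lcap_restr (x : X) (B : set T) : measurable B ->
  exists y : X, \forall t \ae mu, (y : L0) t = (x : L0) t * \1_B t.
Proof.
move=> mB; have mx : measurable_fun setT ((x : L0) : T -> R) by exact: L0_measurable.
have le t : `|(x : L0) t * \1_B t| <= `|(x : L0) t|.
  by rewrite indicE normrM ler_piMr//; case: (_ \in _); rewrite ?normr1 ?normr0.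
have mxB : measurable_fun setT (fun t => (x : L0) t * \1_B t : R).
  by apply: measurable_funM => //; exact: measurable_indic.
apply: (@Lcap_exists _ `|x|) => //.
  apply: (@le_lt_trans _ _ (pint (x : L0))).
    by apply: le_pint => //; apply: aeW.
  by apply: le_lt_trans (Lcap_pint_le x) _; exact: ltry.
by apply: filterS (Lcap_ae_le x) => t; exact: le_trans.
Qed.

Lemma Lcap_indic (E A : set T) : measurable E -> measurable A -> E `<=` A ->
  (mu A < +oo)%E -> exists e : X, \forall t \ae mu, (e : L0) t = \1_E t.
Proof.
move=> mE mA EA muA.
apply: (@Lcap_exists (\1_E) 1); first exact: measurable_indic.
  rewrite /pint (_ : (fun t => _) = (fun t => (\1_E t)%:E)).
    rewrite integral_indic// setIT (le_lt_trans _ muA)// le_measure// inE//.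
  apply/funext => t; rewrite indicE.
  by case: (_ \in _); rewrite ?normr1 ?powR1 ?normr0 ?powR0 ?gt_eqF.
by apply: aeW => t; rewrite indicE; case: (_ \in _); rewrite ?normr1 ?normr0.
Qed.

(** For functions supported in a set of finite measure, the supremum norm
    controls the norm of the intersection; the factor also bounds the p-th root of
    the measure, p being at least 1. *)
Lemma Lcap_norm_on (x : X) (c : R) (A : set T) : 0 <= c -> measurable A ->
  (mu A < +oo)%E -> (\forall t \ae mu, `|(x : L0) t| <= c * \1_A t) ->
  `|x| <= c * (1 + fine (mu A)).
Proof.
move=> c0 mA muA xA; set w := 1 + _.
have muE : mu A = (fine (mu A))%:E by rewrite fineK// ge0_fin_numE.
have m0 : 0 <= fine (mu A) by rewrite fine_ge0.
have w1 : 1 <= w by rewrite lerDl.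
have mx : measurable_fun setT ((x : L0) : T -> R) by exact: L0_measurable.
have le1 t : `|c * \1_A t| = c * \1_A t.
  by rewrite ger0_norm// mulr_ge0// indicE.
apply: Lcap_norm_le => //; first by rewrite mulr_ge0// (le_trans _ w1).
  apply: (@le_trans _ _ (pint (fun t => c * \1_A t : R))).
    apply: le_pint => //.
      by apply: measurable_funM => //; exact: measurable_indic.
    by apply: filterS xA => t; rewrite le1.
  rewrite /pint (_ : (fun t => _) = (fun t => (c `^ p * \1_A t)%:E)); last first.
    apply/funext => t; rewrite le1 indicE; case: (_ \in _).
      by rewrite !mulr1.
    by rewrite !mulr0 powR0 ?gt_eqF.
  rewrite integral_realZ ?powR_ge0//.
  rewrite integral_indic// setIT muE -EFinM lee_fin powRM//; last first.
    by rewrite (le_trans _ w1).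
  rewrite ler_wpM2l ?powR_ge0// (le_trans _ (le1r_powR w1 p1'))//.
  by rewrite lerDr.
apply: filterS xA => t /le_trans; apply; rewrite ler_wpM2l//.
by rewrite (le_trans _ w1)// indicE; case: (_ \in _).
Qed.

End spaces.

(** * Discretization and truncation of functions *)

Section truncation.
Local Open Scope classical_set_scope.
Local Open Scope ring_scope.
Context d (T : measurableType d) (R : realType).
Variables (mu : {measure set T -> \bar R}) (p : R).
Hypothesis p0 : 0 < p.

(** The cells are the level sets, with mesh [h], of the joint values of the [x n].
    The last clause says in a usable form that they are disjoint. *)
Lemma discretization (N : nat) (x : 'I_N -> T -> R) (b h : R) (A : set T) :
  (forall n, measurable_fun setT (x n)) -> 0 < h -> measurable A ->
  exists (I : finType) (E : I -> set T) (z : 'I_N -> I -> R),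
  [/\ forall i, measurable (E i),
      forall i t, E i t -> A t,
      forall i t, E i t -> forall n, `|x n t - z n i| <= h,
      forall t, A t -> (forall n, `|x n t| <= b) ->
        exists i, E i t &
      forall (v : I -> R) i t, E i t -> \sum_j v j * \1_(E j) t = v i].
Proof.
move=> mx h0 mA.
pose x' n t := (x n t + b) / h.
have mx' n : measurable_fun setT (x' n).
  by apply: measurable_funM => //; apply: measurable_funD.
pose K := Num.truncn ((b + b) / h).
pose I : finType := {ffun 'I_N -> 'I_K.+1}.
pose E (i : I) := A `&` \bigcap_(n in [set: 'I_N])
  (x' n @^-1` `[(i n)%:R, (i n).+1%:R[%classic).
have Etrunc i t n : E i t -> (i n : nat) = Num.truncn (x' n t).
  move=> [_ /(_ n Logic.I)] /=; rewrite in_itv /= => H.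
  by apply/esym/truncn_def.
have Einj i j t : E i t -> E j t -> i = j.
  move=> Ei Ej; apply/ffunP => n; apply: val_inj => /=.
  by rewrite (Etrunc _ _ _ Ei) (Etrunc _ _ _ Ej).
exists I, E, (fun n (i : I) => h * (i n)%:R - b); split.
- move=> i; apply: measurableI => //; apply: fin_bigcap_measurable => //.
  move=> n _; rewrite -[X in measurable X]setTI; apply: mx' => //.
- by move=> i t [].
- move=> i t [_ Eit] n; have := Eit n Logic.I; rewrite /= in_itv /= /x'.
  rewrite ler_pdivlMr// ltr_pdivrMr// -natr1 mulrDl mul1r => /andP[].
  move: (i n)%:R (x n t) => u w h1 h2.
  rewrite ler_norml; apply/andP; split; lra.
- move=> t At xb.
  have x'0 n : 0 <= x' n t.
    have := xb n; rewrite ler_norml => /andP[h1 _].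
    by rewrite divr_ge0 ?(ltW h0)//; lra.
  have x'K n : (Num.truncn (x' n t) < K.+1)%N.
    rewrite ltnS le_truncn// ler_pM2r ?invr_gt0//.
    by have := xb n; rewrite ler_norml => /andP[_ h2]; lra.
  exists [ffun n => Ordinal (x'K n)]; split => // n _.
  by rewrite /= in_itv ffunE /= truncn_itv.
- move=> v i t Ei; rewrite (bigD1 i)//= indicE mem_set// mulr1 big1 ?addr0//.
  move=> j ji; rewrite indicE memNset ?mulr0// => Ej.
  by move: ji; rewrite (Einj _ _ _ Ei Ej) eqxx.
Qed.

Lemma chebyshev_finite (f : T -> R) (c : R) : measurable_fun setT f -> 0 < c ->
  (pint mu p f < +oo)%E -> (mu [set t | (c < `|f t|)%R] < +oo)%E.
Proof.
move=> mf c0 fy; set A := [set t | _].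
have mA : measurable A.
  rewrite /A -[X in measurable X]setTI.
  by apply: (@measurable_fun_ltr _ T R setT (cst c) (fun t => `|f t|)) => //;
     exact: measurableT_comp.
have cp : 0 < c `^ p by rewrite powR_gt0.
have h : ((c `^ p)%:E * mu A <= pint mu p f)%E.
  rewrite -integral_cst//.
  apply: (@le_trans _ _ (\int[mu]_(t in A) (`|f t| `^ p)%:E)%E).
    apply: (@le_integral_real _ _ _ _ _ mA (cst (c `^ p))) => //.
      exact: measurable_normp.
    by move=> t /= At; rewrite powR_ge0 /=; apply: ge0_ler_powR;
      rewrite ?nnegrE ?(ltW p0) ?(ltW c0)//; exact: ltW.
  apply: ge0_subset_integral => //.
  by apply/measurable_EFinP; exact: measurable_normp.
rewrite ltNge leye_eq; apply/negP => /eqP muA; move: h.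
by rewrite muA gt0_muley ?lte_fin// leye_eq => /eqP e; rewrite e ltxx in fy.
Qed.

(** The sets where |f| > 1 / (k + 1) have finite measure and, by dominated
    convergence, they exhaust f in L^p; off them f is at most 1 / (k + 1), so one
    of them serves for both norms. *)
Lemma tail_set (f : T -> R) (c : R) : measurable_fun setT f -> 0 < c ->
  (pint mu p f < +oo)%E ->
  exists A : set T, [/\ measurable A, (mu A < +oo)%E,
    (pint mu p (fun t => f t * \1_(~` A) t)%R <= (c `^ p)%:E)%E &
    forall t, `|f t * \1_(~` A) t| <= c].
Proof.
move=> mf c0 fy.
pose A k := [set t | k.+1%:R^-1 < `|f t|].
have mA k : measurable (A k).
  rewrite /A -[X in measurable X]setTI.
  apply: (@measurable_fun_ltr _ T R setT (cst k.+1%:R^-1) (fun t => `|f t|)) => //.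
  exact: measurableT_comp.
pose F k t := (`|f t * \1_(~` A k) t| `^ p)%:E.
have mfA k : measurable_fun setT (fun t => f t * \1_(~` A k) t).
  by apply: measurable_funM => //; apply: measurable_indic; exact: measurableC.
have Fle k t : `|f t * \1_(~` A k) t| <= k.+1%:R^-1.
  rewrite indicE; case: (boolP (t \in ~` A k)); rewrite ?mulr0 ?normr0//.
  by rewrite inE mulr1 /A /= => /negP; rewrite -leNgt.
have Fle2 k t : `|f t * \1_(~` A k) t| <= `|f t|.
  by rewrite indicE normrM ler_piMr//; case: (_ \in _); rewrite ?normr1 ?normr0.
have cv : (\int[mu]_t F k t @[k --> \oo] --> \int[mu]_t (cst 0 t))%E.
  apply: (@dominated_cvg _ _ _ mu setT measurableT F (cst 0%E)
     (fun t => (`|f t| `^ p)%:E)) => //.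
  - by move=> k; apply/measurable_EFinP; exact: measurable_normp.
  - move=> t _; apply: cvg_near_cst.
    have [ft0|ft0] := eqVneq (f t) 0.
      by apply: nearW => k; rewrite /F ft0 mul0r normr0 powR0 ?gt_eqF.
    have ft : 0 < `|f t| by rewrite normr_gt0.
    near=> k; rewrite /F indicE memNset ?mulr0 ?normr0 ?powR0 ?gt_eqF//=; apply.
    rewrite /A /=.
    by near: k; exact: (near_infty_natSinv_lt (PosNum ft)).
  - apply/integrableP; split.
      by apply/measurable_EFinP; exact: measurable_normp.
    under eq_integral do rewrite gee0_abs ?lee_fin ?powR_ge0//.
    exact: fy.
  - move=> k t _; rewrite gee0_abs ?lee_fin ?powR_ge0//.
    by rewrite ge0_ler_powR ?nnegrE// ltW.
rewrite integral0 in cv.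
have cp : (0 < (c `^ p)%:E)%E by rewrite lte_fin powR_gt0.
have [k _ /(_ k (leqnn k)) [/= hk1 hk2]] : \forall k \near \oo,
    (\int[mu]_t F k t < (c `^ p)%:E)%E /\ k.+1%:R^-1 < c.
  near=> k; split; near: k; last exact: (near_infty_natSinv_lt (PosNum c0)).
  by apply: (cv [set y | (y < (c `^ p)%:E)%E]); exact: open_ereal_lt'.
exists (A k); split => //.
- by apply: chebyshev_finite => //; rewrite invr_gt0.
- exact: ltW.
- by move=> t; rewrite (le_trans (Fle k t))// ltW.
Unshelve. all: by end_near. Qed.

Lemma ae_forall_fin (I : finType) (P : I -> T -> Prop) :
  (forall i, \forall t \ae mu, P i t) -> \forall t \ae mu, forall i, P i t.
Proof.
move=> H; have : \forall t \ae mu, forall n : nat,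
    if unpickle n is Some i then P i t else True.
  by apply: ae_foralln => n; case: unpickle => [i|]; [exact: H|exact: aeW].
by apply: filterS => t Ht i; have := Ht (pickle i); rewrite pickleK.
Qed.

End truncation.

(** * Operators on L^p and the intersection that factor the identity *)

Section lifting.
Local Open Scope classical_set_scope.
Local Open Scope ring_scope.
Context d (T : measurableType d) (R : realType).
Variables (mu : {measure set T -> \bar R}) (p : R) (p1 : (1 <= p%:E)%E).
Local Notation L0 := {mfun_ mu, T >-> measurableTypeR R}.
Local Notation X := (LcapLinfty mu p1).
Local Notation Z := (LspaceType mu p1).

Let p1' : 1 <= p. Proof. by rewrite -lee_fin. Qed.
Let p0 : 0 < p. Proof. exact: lt_le_trans p1'. Qed.

Hypothesis mu0 : (0 < mu setT)%E.
Variable D : set T.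
Hypothesis mD : measurable D.
Hypothesis muD : mu D = 1%E.

(** The L^1 seminorm on [D], taken on representatives. *)
Definition absint (f : T -> R) : \bar R := (\int[mu]_(t in D) `|f t|%:E)%E.

Lemma ae_absint (f g : T -> R) : measurable_fun setT f -> measurable_fun setT g ->
  (\forall t \ae mu, f t = g t) -> absint f = absint g.
Proof.
move=> mf mg fg; apply: ge0_ae_eq_integral => //.
- apply/measurable_EFinP; apply: measurable_funTS; exact: measurableT_comp.
- apply/measurable_EFinP; apply: measurable_funTS; exact: measurableT_comp.
- by apply: filterS fg => t ->.
Qed.

Lemma absintD (f g : T -> R) : measurable_fun setT f -> measurable_fun setT g ->
  (absint (fun t => f t + g t)%R <= absint f + absint g)%E.
Proof.
move=> mf mg; rewrite /absint -(@integral_realD _ _ _ mu D mD (fun t => `|f t|)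
  (fun t => `|g t|))//; try exact: measurableT_comp.
apply: le_integral_real => //.
- by apply: measurableT_comp => //; apply: measurable_funD.
- by apply: measurable_funD; exact: measurableT_comp.
- by move=> t _; rewrite normr_ge0 ler_normD.
Qed.

Lemma absint_Lspace_le (f : Z) c : 0 < c -> `|f| <= c ->
  (absint (f : L0) <= (2 * c)%:E)%E.
Proof.
move=> c0 fc; have mf : measurable_fun setT ((f : L0) : T -> R) by exact: L0_measurable.
have cp : 0 < c `^ p by rewrite powR_gt0.
pose K := c / c `^ p; have K0 : 0 <= K by rewrite divr_ge0 ?ltW.
have mfp := measurable_normp p mf.
apply: (@le_trans _ _ (\int[mu]_(t in D) (cst c t + K * `|(f : L0) t| `^ p)%:E)%E).
  apply: le_integral_real => //; first exact: measurableT_comp.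
    by apply: measurable_funD => //; exact: measurable_funM.
  move=> t _; rewrite normr_ge0 /=; apply: le_scaled_powR => //.
rewrite integral_realD//; last 3 first.
- exact: measurable_funM.
- by move=> t _ /=; rewrite ltW.
- by move=> t _; rewrite mulr_ge0 ?powR_ge0.
rewrite [X in (X + _)%E](_ : _ = c%:E); last first.
  by rewrite -[RHS]mule1 -muD -(integral_cst mu mD).
rewrite integral_realZ//.
rewrite mulr_natl mulr2n EFinD leeD2l//.
apply: (@le_trans _ _ (K%:E * (c `^ p)%:E)%E).
  rewrite lee_wpmul2l ?lee_fin//.
  apply: (@le_trans _ _ (pint mu p (f : L0))).
    apply: ge0_subset_integral => //.
    by apply/measurable_EFinP.
  rewrite Lspace_pint lee_fin; apply: ge0_ler_powR; rewrite ?nnegrE ?(ltW p0)//.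
  exact: ltW.
by rewrite -EFinM lee_fin /K divfK// gt_eqF.
Qed.

Variable r : nat -> T -> R.
Hypothesis mr : forall n, measurable_fun setT (r n).
Hypothesis r1 : forall n t, D t -> `|r n t| = 1.
Hypothesis r0 : forall n t, ~ D t -> r n t = 0.
Hypothesis orth : forall N (a : nat -> R),
  (\int[mu]_(t in D) ((\sum_(n < N) a n * r n t) ^+ 2)%:E
   <= (\sum_(n < N) a n ^+ 2)%:E)%E.
Variable rad : nat -> Z.
Hypothesis radE : forall n, \forall t \ae mu, (rad n : L0) t = r n t.

(** On [D] the sum is at most sqrt N * s and its mean square is at most s ^ 2. With
    u = |sum| / (delta * sqrt N * s) <= 1 / delta, the power u ^ p is at most
    delta ^ (1 - p) * u, whose integral is at most delta ^ (- p) / sqrt N <= 1. This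
    weak form of Khinchine's inequality treats all finite p alike. *)
Lemma norm_rad_sum_le (delta s : R) N (a : nat -> R) :
  0 < delta -> 0 < s -> (0 < N)%N -> delta^-1 `^ p <= Num.sqrt N%:R ->
  \sum_(n < N) a n ^+ 2 <= s ^+ 2 ->
  `|\sum_(n < N) a n *: rad n| <= delta * Num.sqrt N%:R * s.
Proof.
move=> d0 s0 N0 dN as2; set q := Num.sqrt N%:R in dN *.
have q0 : 0 < q by rewrite sqrtr_gt0 ltr0n.
have k0 : 0 < delta * q by rewrite mulr_gt0.
set l := delta * q * s; have l0 : 0 < l by rewrite mulr_gt0.
have lp : 0 < l `^ p by rewrite powR_gt0.
pose f t := \sum_(n < N) a n * r n t.
have mf : measurable_fun setT f.
  by apply: measurable_sum => n; exact: measurable_funM.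
have fE : \forall t \ae mu, ((\sum_(n < N) a n *: rad n : Z) : L0) t = f t.
  have := @Lspace_lincombE _ _ _ mu p p1 'I_N (index_enum 'I_N) (fun n => a n)
    (fun n => rad n).
  have : \forall t \ae mu, forall n, (rad n : L0) t = r n t by exact: ae_foralln.
  apply: filterS2 => t h ->; apply: eq_bigr => n _; by rewrite h.
apply: Lspace_norm_le; first exact: ltW.
rewrite (ae_pint p _ _ fE) //; last exact: L0_measurable.
have f0 t : ~ D t -> `|f t| `^ p = 0.
  move=> Dt; rewrite /f big1 ?normr0 ?powR0 ?gt_eqF// => n _.
  by rewrite r0 ?mulr0.
rewrite /pint (@integral_restrT _ _ _ mu D)//; last exact: measurable_normp.
have fq t : D t -> `|f t| <= q * s.
  move=> Dt; apply: (@le_trans _ _ (\sum_(n < N) `|a n|)).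
    rewrite (le_trans (ler_norm_sum _ _ _))// ler_sum// => n _.
    by rewrite normrM r1 ?mulr1.
  rewrite (le_trans (sum_norm_le _ (fun n : 'I_N => a n)))//.
  rewrite size_index_enum card_ord -/q ler_wpM2l ?(ltW q0)//.
  by rewrite -[leRHS]ger0_norm ?(ltW s0)// -sqrtr_sqr ler_sqrt ?sqr_ge0.
(* The bound for u ^ p is made quadratic by 2 u <= k u ^ 2 + 1 / k, where
   k = delta * sqrt N. *)
pose c := l `^ p * delta^-1 `^ (p - 1).
have c0 : 0 < c by rewrite mulr_gt0// powR_gt0// invr_gt0.
pose A := c * (delta * q) / (2 * l ^+ 2); pose B := c / (2 * (delta * q)).
have A0 : 0 <= A.
  by apply/ltW/divr_gt0; apply: mulr_gt0 => //; rewrite exprn_gt0.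
have B0 : 0 <= B by apply/ltW/divr_gt0 => //; apply: mulr_gt0.
have pt t : D t -> `|f t| `^ p <= A * f t ^+ 2 + cst B t.
  move=> Dt; pose u := `|f t| / l.
  have u0 : 0 <= u by rewrite divr_ge0// ltW.
  have ud : u <= delta^-1.
    rewrite /u ler_pdivrMr// (le_trans (fq _ Dt))// /l.
    by rewrite -mulrA mulKf// gt_eqF.
  have -> : `|f t| `^ p = l `^ p * (u * u `^ (p - 1)).
    by rewrite mulr_powRB1// -powRM ?(ltW l0)// /u mulrC divfK// gt_eqF.
  apply: (@le_trans _ _ (c * u)).
    rewrite /c -mulrA ler_wpM2l ?(ltW lp)// mulrC ler_wpM2r//.
    apply: ge0_ler_powR; rewrite ?nnegrE ?subr_ge0// invr_ge0 ltW//.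
  have -> : f t ^+ 2 = u ^+ 2 * l ^+ 2.
    by rewrite -exprMn /u divfK ?gt_eqF// real_normK ?num_real.
  rewrite /A /B /cst [leRHS](_ : _ =
    c * (((delta * q) * u ^+ 2 + (delta * q)^-1) / 2)); last first.
    by field; rewrite !gt_eqF.
  rewrite ler_wpM2l ?(ltW c0)// ler_pdivlMr//.
  rewrite -subr_ge0 [leRHS](_ : _ = (delta * q) * (u - (delta * q)^-1) ^+ 2).
    by rewrite mulr_ge0 ?sqr_ge0 ?ltW.
  by field; rewrite !gt_eqF.
apply: (@le_trans _ _ (\int[mu]_(t in D) (A * f t ^+ 2 + cst B t)%:E)%E).
  apply: le_integral_real => //; first exact: measurable_normp.
    by apply: measurable_funD => //; apply: measurable_funM => //; exact: measurable_funX.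
  by move=> t Dt; rewrite powR_ge0 pt.
rewrite integral_realD//; last 2 first.
- by apply: measurable_funM => //; exact: measurable_funX.
- by move=> t _; rewrite mulr_ge0 ?sqr_ge0.
rewrite integral_realZ//; last 2 first.
- exact: measurable_funX.
- by move=> t _; rewrite sqr_ge0.
rewrite [X in (_ + X)%E](_ : _ = B%:E); last first.
  by rewrite -[RHS]mule1 -muD -(integral_cst mu mD).
apply: (@le_trans _ _ (A%:E * (s ^+ 2)%:E + B%:E)%E).
  rewrite leeD2r// lee_wpmul2l ?lee_fin//.
  by apply: le_trans (orth _ _) _; rewrite lee_fin.
rewrite -EFinM -EFinD lee_fin.
have -> : A * s ^+ 2 + B = l `^ p * (delta^-1 * delta^-1 `^ (p - 1)) / q.
  rewrite /A /B /c /l; field.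
  by rewrite !gt_eqF.
rewrite mulr_powRB1 ?invr_ge0 ?(ltW d0)// ler_pdivrMr// ler_wpM2l// ltW//.
Qed.

Lemma norm_rad_le1 n : `|rad n| <= 1.
Proof.
apply: Lspace_norm_le => //; rewrite powR1 (ae_pint p _ _ (radE n))//.
  rewrite /pint (@integral_restrT _ _ _ mu D)//.
  - rewrite -[leRHS]muD -[leRHS]mul1e -(integral_cst mu mD) /=.
    apply: le_integral_real => //; first exact: measurable_normp.
    by move=> t Dt /=; rewrite r1// powR1 lexx ler01.
  - exact: measurable_normp.
  - by move=> t Dt; rewrite r0// normr0 powR0// gt_eqF.
exact: L0_measurable.
Qed.

Variables (U : {linear Z -> X}) (S : {linear X -> Z}) (CU CS : R).
Hypotheses (CU0 : 0 < CU) (CS0 : 0 < CS).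
Hypothesis UC : forall f, `|U f| <= CU * `|f|.
Hypothesis SC : forall x, `|S x| <= CS * `|x|.

Lemma absint_S_le (x : X) c : 0 < c -> `|x| <= c ->
  (absint (S x : L0) <= (2 * (CS * c))%:E)%E.
Proof.
move=> c0 xc; apply: absint_Lspace_le => //; first exact: mulr_gt0.
by rewrite (le_trans (SC x))// ler_pM2l.
Qed.

(** Discretize the x_n = U (rad n), n < N, on [A] with mesh 1 / sqrt N. On each
    non-null cell the values z n satisfy sum_n |z n| ^ 2 <= b ^ 2, where
    b = CU * delta * sqrt N + 1, as one sees by evaluating the sum of the z n * x_n at
    a point of the cell. Grothendieck's inequality and the Cauchy-Schwarz
    inequality then bound the sum over n < N of the L^1 norms by
    sqrt N * 8 * L * b, which is N * eta / 2 + O(sqrt N). *)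
Lemma small_on_finite (A : set T) (eta : R) : measurable A -> (mu A < +oo)%E ->
  0 < eta -> exists (n : nat) (y : X),
  (\forall t \ae mu, (y : L0) t = (U (rad n) : L0) t * \1_A t) /\
  (absint (S y : L0) <= eta%:E)%E.
Proof.
move=> mA muA eta0.
set w : R := 1 + fine (mu A).
have w0 : 0 < w by rewrite ltr_pwDl// fine_ge0.
set L := 2 * (CS * w); have L0' : 0 < L by rewrite mulr_gt0// mulr_gt0.
(* This choice makes the main term 8 * L * CU * delta equal to eta / 2; [Q] makes N
   large enough both for [norm_rad_sum_le] and for the remaining terms, which
   are of order L * sqrt N. *)
pose delta := eta / (16 * L * CU).
have d0 : 0 < delta by apply: divr_gt0 => //; do 2! apply: mulr_gt0 => //.
pose Q := 18 * L / eta + delta^-1 `^ p + 1.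
have Q0 : 0 < Q.
  apply: ltr_wpDl => //; apply: addr_ge0; last exact: powR_ge0.
  by apply/ltW/divr_gt0 => //; apply: mulr_gt0.
pose N := (Num.bound (Q ^+ 2)).+1.
pose q : R := Num.sqrt N%:R.
have Qq : Q <= q.
  rewrite -[Q]ger0_norm ?(ltW Q0)// -sqrtr_sqr ler_sqrt//.
  rewrite (le_trans (ltW (archi_boundP (sqr_ge0 Q))))// ler_nat//.
have q0 : 0 < q by exact: lt_le_trans Qq.
have qq : q ^+ 2 = N%:R by rewrite sqr_sqrtr.
pose h := q^-1; have h0 : 0 < h by rewrite invr_gt0.
pose x (n : 'I_N) : T -> R := (U (rad n) : L0).
have mx n : measurable_fun setT (x n) by exact: L0_measurable.
have xb : \forall t \ae mu, forall n, `|x n t| <= CU.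
  apply: (@filterS _ _ _ (fun t => forall n, `|(U (rad n) : L0) t| <= CU)).
    by move=> t H n; exact: H.
  apply: ae_foralln => n; apply: filterS (Lcap_ae_le mu0 (U (rad n))) => t.
  move=> /le_trans; apply; rewrite (le_trans (UC _))// ler_piMr ?(ltW CU0)//.
  exact: norm_rad_le1.
have [I [E [z [mE EA Ez Ecov Esum]]]] := discretization CU mx h0 mA.
have /choice [e eE] : forall i, exists e : X, \forall t \ae mu, (e : L0) t = \1_(E i) t.
  by move=> i; apply: (Lcap_indic p1 mu0 (mE i) mA _ muA) => t; exact: EA.
have /choice [y yE] : forall n : nat, exists y : X,
    \forall t \ae mu, (y : L0) t = (U (rad n) : L0) t * \1_A t.
  by move=> n; exact: Lcap_restr.
apply: contrapT => H.
have Hn n : (eta%:E < absint (S (y n) : L0))%E.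
  by rewrite ltNge; apply/negP => Hn; apply: H; exists n, (y n).
pose g i : T -> R := (S (e i) : L0).
have mg i : measurable_fun setT (g i) by exact: L0_measurable.
have SE (v : I -> R) : absint (lincomb g v) = absint (S (\sum_i v i *: e i) : L0).
  apply/esym/ae_absint => //; first exact: L0_measurable.
    exact: measurable_lincomb.
  rewrite linear_sum; under eq_bigr do rewrite linearZ.
  exact: Lspace_lincombE.
have eN : \forall t \ae mu, forall i, (e i : L0) t = \1_(E i) t.
  exact: ae_forall_fin.
have gL (v : I -> R) : (forall i, `|v i| <= 1) ->
    (\int[mu]_(t in D) `|lincomb g v t|%:E <= L%:E)%E.
  move=> v1; rewrite -/(absint (lincomb g v)) SE.
  apply: absint_S_le => //; rewrite -[w]mul1r.
  apply: Lcap_norm_on => //.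
  apply: filterS2 eN (Lcap_lincombE (index_enum I) v e) => t et ->.
  under eq_bigr do rewrite et.
  have [[i Ei]|nE] := pselect (exists i, E i t).
    by rewrite (Esum v _ _ Ei) indicE mem_set ?mulr1//; exact: EA Ei.
  rewrite big1 ?normr0 ?mulr_ge0// => i _.
  by rewrite indicE memNset ?mulr0// => Ei; apply: nE; exists i.
(* No estimate is available for the values on null cells, which can be changed
   at will. *)
pose z' (n : 'I_N) i : R := if mu (E i) == 0%E then 0 else z n i.
pose b := CU * (delta * q) + 1.
have b0 : 0 < b by rewrite ltr_wpDl// ltW// mulr_gt0// mulr_gt0.
have zb i : \sum_(n < N) z' n i ^+ 2 <= b ^+ 2.
  have [E0|E0] := eqVneq (mu (E i)) 0%E.
    by rewrite big1 ?sqr_ge0// => n _; rewrite /z' E0 eqxx expr0n.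
  rewrite (eq_bigr (fun n => z n i ^+ 2)); last first.
    by move=> n _; rewrite /z' (negPf E0).
  set s2 := \sum_(n < N) _; pose s := Num.sqrt s2.
  have s20 : 0 <= s2 by apply: sumr_ge0 => n _; exact: sqr_ge0.
  have ss : s ^+ 2 = s2 by rewrite sqr_sqrtr.
  have s0 : 0 <= s by exact: sqrtr_ge0.
  rewrite -ss; suff : s <= b by move=> sb; rewrite lerXn2r ?nnegrE ?(ltW b0).
  have [->|sN] := eqVneq s 0; first exact: ltW.
  have s0' : 0 < s by rewrite lt_neqAle eq_sym sN.
  pose a (n : nat) : R := if insub n is Some n' then z n' i else 0.
  have aE (n : 'I_N) : a n = z n i by rewrite /a valK.
  have := Lcap_ae_le mu0 (U (\sum_(n < N) a n *: rad n)).
  rewrite linear_sum; under eq_bigr do rewrite linearZ.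
  have := Lcap_lincombE (index_enum 'I_N) (fun n => a n) (fun n => U (rad n)).
  move=> h1 h2.
  have [t [Et [h1t h2t]]] : exists t, E i t /\
     ((\sum_(n < N) a n *: U (rad n) : X) : L0) t = \sum_(n < N) a n * x n t /\
     `|((\sum_(n < N) a n *: U (rad n) : X) : L0) t| <= `|\sum_(n < N) a n *: U (rad n)|.
    apply: contrapT => nt; move/eqP: E0; apply.
    have [F [mF F0 sF]] := filterI h1 h2.
    apply: (subset_measure0 (mE i) mF _ F0) => t Et; apply: sF => -[h1t h2t].
    by apply: nt; exists t.
  rewrite h1t in h2t.
  have UN : `|\sum_(n < N) a n *: U (rad n)| <= CU * (delta * q * s).
    rewrite (_ : \sum_(n < N) _ = U (\sum_(n < N) a n *: rad n)).
      rewrite (le_trans (UC _))// ler_pM2l//.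
      apply: norm_rad_sum_le => //.
        rewrite (le_trans _ Qq)// /Q addrAC lerDr addr_ge0//.
        by apply/ltW/divr_gt0 => //; apply: mulr_gt0.
      by rewrite ss le_eqVlt; apply/orP; left; apply/eqP/eq_bigr => n _; rewrite aE.
    by rewrite linear_sum; apply: eq_bigr => n _; rewrite linearZ.
  have low : s2 - h * (q * s) <= \sum_(n < N) a n * x n t.
    apply: (@le_trans _ _ (s2 - h * \sum_(n < N) `|z n i|)).
      rewrite lerB// ler_pM2l//.
      rewrite (le_trans (sum_norm_le _ (fun n : 'I_N => z n i)))//.
      by rewrite size_index_enum card_ord.
    rewrite mulr_sumr /s2 -sumrB; apply: ler_sum => n _; rewrite aE.
    have := Ez i t Et n; rewrite ler_norml => hz.
    have : `|z n i * (x n t - z n i)| <= h * `|z n i|.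
      by rewrite normrM mulrC ler_wpM2r// Ez.
    rewrite ler_norml => /andP[+ _]; rewrite expr2 mulrBr => le1.
    by rewrite addrC -lerBrDr.
  have qh : h * (q * s) = s by rewrite mulrA mulVf ?mul1r// gt_eqF.
  rewrite qh -ss in low.
  rewrite -(ler_pM2r s0').
  have := le_trans (le_trans (ler_norm _) h2t) UN.
  by rewrite /b; nra.
pose sq := [seq z' n | n <- index_enum 'I_N].
have Bd := sqfun_bound_scaled mD mg gL (s := sq) b0.
have {}Bd : (\int[mu]_(t in D) (sqfun g sq t)%:E <= (8 * L * b)%:E)%E.
  by apply: Bd => i; rewrite big_map; exact: zb.
have low n : ((eta - L * h)%:E <= absint (lincomb g (z' n)))%E.
  pose v := \sum_i z' n i *: e i.
  have dS : `|y n - v| <= h * w.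
    apply: Lcap_norm_on => //; first exact: ltW.
    have nul : \forall t \ae mu, forall i, mu (E i) = 0%E -> ~ E i t.
      apply: ae_forall_fin => i; have [E0|E0] := pselect (mu (E i) = 0%E).
        apply: (@negligibleS _ _ _ mu (E i)); last exact/negligibleP.
        by move=> t /= /not_implyP[_ /contrapT].
      by apply: aeW => t /E0.
    apply: filterS3 (filterI (yE n) eN)
      (filterI (Lcap_subE (y n) v) (Lcap_lincombE (index_enum I) (z' n) e))
      (filterI xb nul).
    move=> t [yt et] [-> vt] [xt nt]; rewrite /v vt yt.
    under eq_bigr do rewrite et.
    have [At|At] := pselect (A t); last first.
      rewrite [\1_A t]indicE memNset// !mulr0 sub0r normrN big1 ?normr0// => i _.
      by rewrite indicE memNset ?mulr0// => /EA.
    have [i Ei] := Ecov t At xt.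
    rewrite (Esum _ _ _ Ei) [\1_A t]indicE mem_set// !mulr1 /z'.
    case: eqP => [E0|_]; first by case: (nt _ E0 Ei).
    exact: Ez.
  have hw0 : 0 < h * w by rewrite mulr_gt0.
  have Sd := absint_S_le hw0 dS.
  have T1 : (absint (S (y n) : L0) <= absint (S (y n - v)%R : L0) + absint (S v : L0))%E.
    apply: le_trans (absintD (L0_measurable (S (y n - v) : L0))
      (L0_measurable (S v : L0))).
    rewrite le_eqVlt; apply/orP; left; apply/eqP/ae_absint => //.
    - exact: L0_measurable.
    - by apply: measurable_funD; exact: L0_measurable.
    - rewrite linearB; apply: filterS (Lspace_subE (S (y n)) (S v)) => t ->.
      by rewrite subrK.
  rewrite SE -/v.
  have := lt_le_trans (Hn n) T1.
  have : (absint (S (y n - v)%R : L0) <= (L * h)%:E)%E.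
    by rewrite [L * h](_ : _ = 2 * (CS * (h * w))) // /L; ring.
  have : (0 <= absint (S v : L0))%E by apply: integral_ge0 => t _; rewrite lee_fin.
  case: (absint (S v : L0)) => [c| |]; rewrite ?leey//.
  move=> _ h1 h2.
  have := lt_le_trans h2 (leeD2r c%:E h1).
  by rewrite -EFinD lte_fin lee_fin lerBlDl => /ltW.
have up : (\sum_(n < N) absint (lincomb g (z' n)) <= (q * (8 * L * b))%:E)%E.
  rewrite /absint -integral_real_sum//; last first.
    by move=> n; apply: measurableT_comp => //; exact: measurable_lincomb.
  apply: (@le_trans _ _ (\int[mu]_(t in D) (q * sqfun g sq t)%:E)%E).
    apply: le_integral_real => //.
    - apply: measurable_sum => n; apply: measurableT_comp => //.
      exact: measurable_lincomb.
    - by apply: measurable_funM => //; exact: measurable_sqfun.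
    - move=> t _; rewrite sumr_ge0//= /sqfun big_map.
      have := sum_norm_le (index_enum 'I_N) (fun n => lincomb g (z' n) t).
      by rewrite size_index_enum card_ord.
  rewrite integral_realZ ?(ltW q0)//; last 2 first.
  - exact: measurable_sqfun.
  - by move=> t _; exact: sqrtr_ge0.
  by rewrite [leRHS]EFinM lee_wpmul2l// lee_fin ltW.
have : ((N%:R * (eta - L * h))%:E <= (q * (8 * L * b))%:E)%E.
  apply: le_trans up; rewrite -[X in X%:R]card_ord mulr_natl -sumr_const -sumEFin.
  exact: lee_sum.
rewrite lee_fin -qq; apply/negP; rewrite -ltNge.
have e1 : 16 * (L * (CU * delta)) = eta.
  by rewrite /delta; field; rewrite !gt_eqF.
have e2 : 18 * L < q * eta.
  rewrite -ltr_pdivrMr//; apply: lt_le_trans Qq.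
  by rewrite /Q -addrA ltrDl ltr_pwDr// powR_ge0.
rewrite [ltRHS](_ : _ = q * (q * eta - L)); last by rewrite /h; field; rewrite gt_eqF.
rewrite ltr_pM2l// /b.
rewrite [ltLHS](_ : _ = q * (16 * (L * (CU * delta))) / 2 + 8 * L); last by field.
by rewrite e1; lra.
Qed.

Hypothesis SU : forall f, S (U f) = f.

(** [y k] is the restriction of [U (rad (n k))] to [B k], the sets [B k] are
    disjoint, and [S (y k)] is eta-close to [rad (n k)]. Repetitions among the
    indices [n k] are allowed. *)
Definition pieces N (eta : R) (n : nat -> nat) (B : nat -> set T)
    (y : nat -> X) := forall k, (k < N)%N ->
  [/\ measurable (B k),
      \forall t \ae mu, (y k : L0) t = (U (rad (n k)) : L0) t * \1_(B k) t,
      (absint (S (y k) - rad (n k) : Z)%R <= eta%:E)%E &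
      forall j, (j < N)%N -> j != k -> forall t, B k t -> ~ B j t].

(** With x = U (rad n), the piece is what remains of x after the removal of x 1_A,
    which [S] makes small for a good choice of n, and of a tail that is small in
    norm; since S x = rad n, it is mapped close to rad n. The next pieces are taken
    off the set [A'], of finite measure, on which this one lives. *)
Lemma pieces_exist N (eta : R) (A : set T) : 0 < eta -> measurable A ->
  (mu A < +oo)%E -> exists n B y, pieces N eta n B y /\
  forall k, (k < N)%N -> forall t, B k t -> ~ A t.
Proof.
move=> eta0; elim: N A => [|N IH] A mA muA.
  by exists (fun=> 0%N), (fun=> set0), (fun=> 0).
have eta2 : 0 < eta / 2 by rewrite divr_gt0.
have [n0 [z0 [z0E z0S]]] :=
  small_on_finite mA muA eta2.
set x := U (rad n0) in z0E *.
pose c := eta / (4 * CS); have c0 : 0 < c by rewrite divr_gt0// mulr_gt0.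
have xy : (pint mu p (x : L0) < +oo)%E.
  by apply: le_lt_trans (Lcap_pint_le x) _; exact: ltry.
have [A1 [mA1 muA1 tp tc]] := tail_set p0 (L0_measurable (x : L0)) c0 xy.
pose A' := A `|` A1.
have mA' : measurable A' by exact: measurableU.
have muA' : (mu A' < +oo)%E.
  by apply: le_lt_trans (measureU2 _ _ _) _ => //; rewrite lte_add_pinfty.
pose B0 := A' `\` A; have mB0 : measurable B0 by exact: measurableD.
have [y0 y0E] := Lcap_restr mu0 x mB0.
have mA'C : measurable (~` A') by exact: measurableC.
have [z1 z1E] := Lcap_restr mu0 x mA'C.
have z1c : `|z1| <= c.
  have h : \forall t \ae mu, `|(z1 : L0) t| <= `|(x : L0) t * \1_(~` A1) t|.
    apply: filterS z1E => t ->; rewrite !normrM ler_wpM2l// !indicE.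
    case: (boolP (t \in ~` A')) => tA'; last by rewrite normr0.
    rewrite (_ : t \in ~` A1)// inE => tA1.
    by move: tA'; rewrite inE; apply; right.
  apply: (Lcap_norm_le mu0); first exact: ltW.
    apply: le_trans tp; apply: le_pint => //; first exact: L0_measurable.
    apply: measurable_funM; first exact: L0_measurable.
    by apply: measurable_indic; exact: measurableC.
  by apply: filterS h => t /le_trans; exact.
have xE : x = z0 + y0 + z1.
  apply: Lcap_eqP.
  apply: filterS3 (filterI z0E y0E) z1E
    (filterI (L0_addE (z0 + y0 : X) (z1 : L0)) (L0_addE (z0 : L0) (y0 : L0))).
  move=> t [z0t y0t] z1t [/(_ Logic.I) e1 /(_ Logic.I) e2].
  rewrite [RHS]e1 /= [X in _ = X + _]e2 /= z0t y0t z1t -!mulrDr.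
  rewrite [X in _ * X](_ : _ = 1) ?mulr1// !indicE.
  have [At|At] := pselect (A t).
    rewrite mem_set// !memNset ?addr0//; first by move=> /(_ (or_introl At)).
    by move=> [].
  rewrite memNset// add0r; have [A't|A't] := pselect (A' t).
    by rewrite mem_set// memNset ?addr0//; apply.
  by rewrite memNset ?mem_set ?add0r// => -[].
have y0S : (absint (S y0 - rad n0 : Z)%R <= eta%:E)%E.
  have e1 : S y0 - rad n0 = - S z0 - S z1.
    have := congr1 S xE; rewrite (linearD S) (linearD S) /x SU => ->.
    by rewrite opprD addrA opprD addrCA subrr addr0.
  have h : \forall t \ae mu,
      `|((S y0 - rad n0 : Z) : L0) t| <= `|(S z0 : L0) t| + `|(S z1 : L0) t|.
    rewrite e1; apply: filterS2 (Lspace_subE (- S z0) (S z1)) (L0_oppE (S z0 : L0)).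
    move=> t -> /(_ Logic.I) e; rewrite [X in `|X - _|]e /=.
    by rewrite (le_trans (ler_normB _ _))// normrN.
  apply: (@le_trans _ _ (absint (S z0 : L0) + absint (S z1 : L0))%E); last first.
    rewrite [eta](_ : _ = eta / 2 + 2 * (CS * c)).
      by rewrite EFinD leeD// absint_S_le.
    by rewrite /c; field; rewrite gt_eqF.
  rewrite /absint -integral_realD//; last 2 first.
  - by apply: measurableT_comp => //; exact: L0_measurable.
  - by apply: measurableT_comp => //; exact: L0_measurable.
  apply: ae_ge0_le_integral => //.
  - apply/measurable_EFinP/measurable_funTS/measurableT_comp => //.
  - apply/measurable_EFinP/measurable_funTS; apply: measurable_funD.
      by apply: measurableT_comp => //; exact: L0_measurable.
    by apply: measurableT_comp => //; exact: L0_measurable.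
  - by apply: filterS h => t h _; rewrite lee_fin.
have [n [B [y [P PA]]]] := IH A' mA' muA'.
exists (fun k => if k is k'.+1 then n k' else n0),
  (fun k => if k is k'.+1 then B k' else B0),
  (fun k => if k is k'.+1 then y k' else y0); split.
  move=> [_|k]; [split => //|].
    by move=> [//|j] jN _ t [A't _] Bjt; exact: PA Bjt A't.
  rewrite ltnS => kN; have [h1 h2 h3 h4] := P k kN; split => //.
  move=> [_ _ t Bkt [A't _]|j jN jk]; first exact: PA Bkt A't.
  exact: h4.
move=> [_ t []//|k kN t Bt At].
by apply: (PA k kN t Bt); left.
Qed.

Lemma pieces_nth N eta n B y (s : seq nat) : uniq s -> all (fun k => k < N)%N s ->
  pieces N eta n B y -> pieces (size s) eta (fun j => n (nth 0%N s j))
    (fun j => B (nth 0%N s j)) (fun j => y (nth 0%N s j)).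
Proof.
move=> us /all_nthP sN P k ks.
have [h1 h2 h3 h4] := P _ (sN 0%N k ks); split => // j js jk.
by apply: h4; [exact: sN|rewrite nth_uniq].
Qed.

Lemma pieces_ae N eta n B y : pieces N eta n B y ->
  \forall t \ae mu, forall k : 'I_N, (y k : L0) t = (U (rad (n k)) : L0) t * \1_(B k) t.
Proof. by move=> P; apply: ae_forall_fin => k; have [] := P k (ltn_ord k). Qed.

(** The pointwise form of disjointness: it makes p-th powers of signed sums of
    pieces additive and their absolute values bounded by that of one piece. *)
Lemma pieces_single N eta n B y : pieces N eta n B y ->
  \forall t \ae mu, (forall k : 'I_N, (y k : L0) t = 0) \/
    exists k : 'I_N, (y k : L0) t = (U (rad (n k)) : L0) t /\
      forall j : 'I_N, j != k -> (y j : L0) t = 0.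
Proof.
move=> P; apply: filterS (pieces_ae P) => t yt.
have [[k Bk]|nB] := pselect (exists k : 'I_N, B k t).
  right; exists k; split; first by rewrite yt indicE mem_set// mulr1.
  move=> j jk; rewrite yt indicE memNset ?mulr0//.
  by have [_ _ _ h] := P k (ltn_ord k); apply: h.
left=> k; rewrite yt indicE memNset ?mulr0// => Bk; apply: nB; by exists k.
Qed.

Lemma pint_pieces N eta n B y : pieces N eta n B y ->
  forall k, (k < N)%N -> (pint mu p (y k : L0) <= (CU `^ p)%:E)%E.
Proof.
move=> P k kN; have [_ yE _ _] := P k kN.
apply: (@le_trans _ _ (pint mu p (U (rad (n k)) : L0))).
  apply: le_pint => //; try exact: L0_measurable.
  apply: filterS yE => t ->; rewrite normrM ler_piMr// indicE.
  by case: (_ \in _); rewrite ?normr1 ?normr0.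
apply: le_trans (Lcap_pint_le _) _; rewrite lee_fin.
apply: ge0_ler_powR; rewrite ?nnegrE ?(ltW p0) ?(ltW CU0)//.
rewrite (le_trans (UC _))// ler_piMr ?(ltW CU0)//.
exact: norm_rad_le1.
Qed.

Let msign (e : nat -> bool) (k : nat) : R := (-1) ^+ e k.

(** Each signed sum w of pieces has norm at most Q, and S w differs from the
    corresponding signed sum of Rademacher functions by at most M * M^-1 = 1 in
    L^1(D); the latter has mean L^1 norm at least sqrt M / 2. *)
Lemma pieces_lower M n B y (Q : R) : (0 < M)%N -> pieces M M%:R^-1 n B y ->
  CU <= Q -> (\sum_(k < M) pint mu p (y k : L0) <= (Q `^ p)%:E)%E ->
  Num.sqrt M%:R <= 4 * (CS * Q) + 2.
Proof.
move=> M0 P CQ yQ.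
have Q0 : 0 < Q by exact: lt_le_trans CQ.
have M0' : 0 < M%:R :> R by rewrite ltr0n.
have yB : \forall t \ae mu, forall k : 'I_M, `|(U (rad (n k)) : L0) t| <= CU.
  apply: ae_forall_fin => k; apply: filterS (Lcap_ae_le mu0 (U (rad (n k)))) => t.
  move=> /le_trans; apply; rewrite (le_trans (UC _))// ler_piMr ?(ltW CU0)//.
  exact: norm_rad_le1.
pose w e : X := \sum_(k < M) msign e k *: y k.
have wE e := @Lcap_lincombE _ _ _ mu p p1 _ (index_enum 'I_M) (fun k => msign e k)
  (fun k => y k).
have m1 e k : `|msign e k| = 1 by rewrite /msign normrX normrN1 expr1n.
have wQ e : `|w e| <= Q.
  have mYp (k : 'I_M) : measurable_fun setT (fun t => `|(y k : L0) t| `^ p).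
    by apply: measurable_normp; exact: L0_measurable.
  apply: Lcap_norm_le => //; first exact: ltW.
    apply: le_trans yQ; rewrite /pint -integral_real_sum//.
    apply: ae_ge0_le_integral => //.
    - by apply/measurable_EFinP; apply: measurable_normp; exact: L0_measurable.
    - by move=> t _; rewrite lee_fin sumr_ge0// => k _; exact: powR_ge0.
    - by apply/measurable_EFinP; apply: measurable_sum.
    - apply: filterS2 (wE e) (pieces_single P) => t -> yt _; rewrite lee_fin.
      case: yt => [yt|[k [_ yt]]].
        rewrite big1; first by rewrite normr0 powR0 ?gt_eqF// sumr_ge0// => k _; exact: powR_ge0.
        by move=> k _; rewrite yt mulr0.
      rewrite (bigD1 k)//= big1 ?addr0; last by move=> j jk; rewrite yt ?mulr0.
      rewrite normrM m1 mul1r (bigD1 k)//= lerDl sumr_ge0//.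
  apply: filterS3 (wE e) (pieces_single P) yB => t -> yt yb.
  case: yt => [yt|[k [ykt yt]]].
    by rewrite big1 ?normr0 ?(ltW Q0)// => k _; rewrite yt mulr0.
  rewrite (bigD1 k)//= big1 ?addr0; last by move=> j jk; rewrite yt ?mulr0.
  by rewrite normrM m1 mul1r ykt (le_trans (yb k)).
pose G e t := signed_sum M (fun k => r (n k) t) e.
have mG e : measurable_fun setT (G e).
  by apply: measurable_sum => k; exact: measurable_funM.
have mGn e : measurable_fun setT (fun t => `|G e t|) by exact: measurableT_comp.
pose dz (k : 'I_M) : Z := S (y k) - rad (n k).
have mdz k : measurable_fun setT (fun t => `|(dz k : L0) t|).
  by apply: measurableT_comp => //; exact: L0_measurable.
have GS e : (absint (G e) <= (2 * (CS * Q) + 1)%:E)%E.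
  have mS : measurable_fun setT (fun t => `|(S (w e) : L0) t|).
    by apply: measurableT_comp => //; exact: L0_measurable.
  have Swl := @Lspace_lincombE _ _ _ mu p p1 _ (index_enum 'I_M)
    (fun k => msign e k) (fun k => S (y k)).
  have SwE : S (w e) = \sum_(k < M) msign e k *: S (y k).
    by rewrite linear_sum; apply: eq_bigr => k _; rewrite linearZ.
  rewrite -SwE in Swl.
  have dE : \forall t \ae mu, forall k : 'I_M,
      (dz k : L0) t = (S (y k) : L0) t - r (n k) t.
    apply: ae_forall_fin => k.
    by apply: filterS2 (Lspace_subE (S (y k)) (rad (n k))) (radE (n k)) => t -> ->.
  apply: (@le_trans _ _ (\int[mu]_(t in D)
      (`|(S (w e) : L0) t| + \sum_(k < M) `|(dz k : L0) t|)%:E)%E).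
    apply: ae_ge0_le_integral => //.
    - exact/measurable_EFinP/measurable_funTS.
    - by move=> t _; rewrite lee_fin addr_ge0// sumr_ge0.
    - apply/measurable_EFinP/measurable_funTS; apply: measurable_funD => //.
      exact: measurable_sum.
    - apply: filterS2 Swl dE => t Sw dt _; rewrite lee_fin.
      have -> : G e t = (S (w e) : L0) t - \sum_(k < M) msign e k * (dz k : L0) t.
        rewrite Sw -sumrB; apply: eq_bigr => k _.
        by rewrite dt mulrBr subKr.
      rewrite (le_trans (ler_normB _ _))// lerD2l (le_trans (ler_norm_sum _ _ _))//.
      by apply: ler_sum => k _; rewrite normrM m1 mul1r.
  rewrite integral_realD//; last 2 first.
  - exact: measurable_sum.
  - by move=> t _; exact: sumr_ge0.
  rewrite EFinD leeD//; first exact: absint_S_le.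
  have := @integral_real_sum_le _ _ _ mu D mD _ (index_enum 'I_M)
    (fun k t => `|(dz k : L0) t|) (M%:R^-1).
  rewrite size_index_enum card_ord mulfV ?gt_eqF//; apply => // k.
  by have [] := P k (ltn_ord k).
have kh t : D t -> 2 ^+ M * Num.sqrt M%:R <= 2 * \sum_(e <- signs M) `|G e t|.
  move=> Dt; have := khinchine_L1 M (fun k => r (n k) t).
  rewrite (eq_bigr (fun=> 1)); last first.
    by move=> k _; rewrite -real_normK ?num_real// r1// expr1n.
  by rewrite sumr_const card_ord.
have N0 : 0 < 2 ^+ M :> R by rewrite exprn_gt0.
have : ((2 ^+ M * Num.sqrt M%:R)%:E <= (2 * (2 ^+ M * (2 * (CS * Q) + 1)))%:E :> \bar R)%E.
  apply: (@le_trans _ _ (\int[mu]_(t in D) (2 * \sum_(e <- signs M) `|G e t|)%:E)%E).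
    rewrite -[leLHS]mule1 -muD -(integral_cst mu mD).
    apply: (@le_integral_real _ _ _ mu D mD (cst _)) => //.
      by apply: measurable_funM => //; exact: measurable_sum.
    by move=> t Dt /=; rewrite kh// mulr_ge0 ?sqrtr_ge0 ?ltW.
  rewrite integral_realZ//; last 2 first.
  - exact: measurable_sum.
  - by move=> t _; exact: sumr_ge0.
  rewrite [leRHS]EFinM lee_wpmul2l ?lee_fin//.
  have := @integral_real_sum_le _ _ _ mu D mD _ (signs M)
    (fun e t => `|G e t|) (2 * (CS * Q) + 1).
  by rewrite size_signs natrX; apply.
rewrite lee_fin [X in _ <= X](_ : _ = 2 ^+ M * (4 * (CS * Q) + 2)); last by ring.
by rewrite ler_pM2l.
Qed.

(** At a point of [B k], the p-th power of the k-th term is at most the mean of those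
    of the signed sums of all the U (rad (n j)). Since [U] is bounded, the integral
    of this mean is controlled by signed sums of Rademacher functions, where,
    with q = sqrt N, |G| ^ p is at most q ^ p (1 + G ^ 2 / q ^ 2), of mean 2 * q ^ p. *)
Lemma pieces_average N eta n B y : p <= 2 -> (0 < N)%N -> pieces N eta n B y ->
  (\sum_(k < N) pint mu p (y k : L0)
   <= (2 * CU `^ p * Num.sqrt N%:R `^ p)%:E)%E.
Proof.
move=> p2 N0 P; set q := Num.sqrt N%:R.
have q0 : 0 < q by rewrite sqrtr_gt0 ltr0n.
have qq : q ^+ 2 = N%:R by rewrite sqr_sqrtr.
pose x k : T -> R := (U (rad (n k)) : L0).
have mx k : measurable_fun setT (x k) by exact: L0_measurable.
have C0 : 0 < 2 ^+ N :> R by rewrite exprn_gt0.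
have mYp (k : 'I_N) : measurable_fun setT (fun t => `|(y k : L0) t| `^ p).
  by apply: measurable_normp; exact: L0_measurable.
pose F e t := signed_sum N (fun k => x k t) e.
have mF e : measurable_fun setT (F e).
  by apply: measurable_sum => k; exact: measurable_funM.
have mFp e : measurable_fun setT (fun t => `|F e t| `^ p) by exact: measurable_normp.
pose G e t := signed_sum N (fun k => r (n k) t) e.
have mG e : measurable_fun setT (G e).
  by apply: measurable_sum => k; exact: measurable_funM.
have mGp e : measurable_fun setT (fun t => `|G e t| `^ p) by exact: measurable_normp.
have h1 : ((2 ^+ N)%:E * \sum_(k < N) pint mu p (y k : L0)
     <= \sum_(e <- signs N) pint mu p (F e))%E.
  rewrite /pint -!integral_real_sum//.
  rewrite -integral_realZ ?(ltW C0)//; last 2 first.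
  - exact: measurable_sum.
  - by move=> t _; apply: sumr_ge0 => k _; exact: powR_ge0.
  apply: ae_ge0_le_integral => //.
  - by move=> t _; rewrite lee_fin mulr_ge0 ?(ltW C0)// sumr_ge0// => k _; exact: powR_ge0.
  - by apply/measurable_EFinP; apply: measurable_funM => //; exact: measurable_sum.
  - by move=> t _; rewrite lee_fin sumr_ge0// => k _; exact: powR_ge0.
  - by apply/measurable_EFinP; exact: measurable_sum.
  - apply: filterS (pieces_single P) => t yt _; rewrite lee_fin.
    case: yt => [yt|[k [ykt yt]]].
      rewrite big1 ?mulr0 ?sumr_ge0// => k _.
      by rewrite yt normr0 powR0 ?gt_eqF.
    rewrite (bigD1 k)//= big1 ?addr0; last first.
      by move=> j jk; rewrite yt// normr0 powR0 ?gt_eqF.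
    rewrite ykt; exact: (le_powR_signed_sum (fun k => x k t) (ltn_ord k) p1').
have FG e : (pint mu p (F e) <= (CU `^ p)%:E * pint mu p (G e))%E.
  pose f : Z := \sum_(k < N) msign e k *: rad (n k).
  have fE : \forall t \ae mu, (f : L0) t = G e t.
    have := @Lspace_lincombE _ _ _ mu p p1 _ (index_enum 'I_N) (fun k => msign e k)
      (fun k => rad (n k)).
    have : \forall t \ae mu, forall n, (rad n : L0) t = r n t by exact: ae_foralln.
    by apply: filterS2 => t h ->; apply: eq_bigr => k _; rewrite h.
  have UfE : \forall t \ae mu, (U f : L0) t = F e t.
    have := @Lcap_lincombE _ _ _ mu p p1 _ (index_enum 'I_N) (fun k => msign e k)
      (fun k => U (rad (n k))).
    rewrite (_ : \sum_(i <- _) _ = U f)//.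
    by rewrite /f linear_sum; apply: eq_bigr => k _; rewrite linearZ.
  rewrite -(ae_pint p (L0_measurable (U f : L0)) (mF e) UfE).
  rewrite -(ae_pint p (L0_measurable (f : L0)) (mG e) fE) Lspace_pint.
  apply: le_trans (Lcap_pint_le _) _; rewrite -EFinM lee_fin -powRM ?(ltW CU0)//.
  apply: ge0_ler_powR; rewrite ?nnegrE ?(ltW p0)//.
  by rewrite mulr_ge0// ltW.
have h2 : (\sum_(e <- signs N) pint mu p (G e) <= (2 ^+ N * (2 * q `^ p))%:E)%E.
  have E e : pint mu p (G e) = (\int[mu]_(t in D) (`|G e t| `^ p)%:E)%E.
    rewrite /pint (@integral_restrT _ _ _ mu D)// => t Dt.
    rewrite /G /signed_sum big1 ?normr0 ?powR0 ?gt_eqF// => k _.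
    by rewrite r0// mulr0.
  under eq_bigr do rewrite E.
  rewrite -integral_real_sum//.
  rewrite -[leRHS]mule1 -muD -(integral_cst mu mD).
  apply: (@le_integral_real _ _ _ mu D mD _ (cst _)) => //.
    exact: measurable_sum.
  move=> t Dt /=; rewrite sumr_ge0 /=; last by move=> e _; exact: powR_ge0.
  apply: (@le_trans _ _ (\sum_(e <- signs N) (q `^ p + q `^ p / N%:R * G e t ^+ 2))).
    apply: ler_sum => e _.
    have -> : `|G e t| `^ p = q `^ p * (`|G e t| / q) `^ p.
      rewrite -powRM ?(ltW q0)//; last by rewrite divr_ge0// ltW.
      by rewrite mulrC divfK// gt_eqF.
    rewrite [leRHS](_ : _ = q `^ p * (1 + (`|G e t| / q) ^+ 2)).
      rewrite ler_wpM2l ?powR_ge0//; apply: powR_le_1sqr => //; first exact: ltW.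
      by rewrite divr_ge0// ltW.
    rewrite expr_div_n real_normK ?num_real// qq mulrDr mulr1 -mulrA.
    by rewrite [_^-1 * _]mulrC.
  rewrite big_split /= sum_signs_cst -mulr_sumr signed_sum_moment2.
  rewrite (eq_bigr (fun=> 1)); last first.
    by move=> k _; rewrite -real_normK ?num_real// r1// expr1n.
  rewrite sumr_const card_ord le_eqVlt; apply/orP; left; apply/eqP.
  have gen (a b c : R) : b != 0 -> a * c + c / b * (a * b) = a * (2 * c).
    by move=> b0; field.
  by apply: gen; rewrite pnatr_eq0 -lt0n.
have h3 : ((2 ^+ N)%:E * \sum_(k < N) pint mu p (y k : L0) <=
   (2 ^+ N)%:E * (2 * CU `^ p * q `^ p)%:E)%E.
  apply: (le_trans h1); apply: (@le_trans _ _
    ((CU `^ p)%:E * \sum_(e <- signs N) pint mu p (G e))%E).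
    rewrite ge0_sume_distrr; first exact: lee_sum.
    by move=> e _; exact: pint_ge0.
  apply: (@le_trans _ _ ((CU `^ p)%:E * (2 ^+ N * (2 * q `^ p))%:E)%E).
    by rewrite lee_wpmul2l// lee_fin powR_ge0.
  by rewrite -!EFinM lee_fin le_eqVlt; apply/orP; left; apply/eqP; ring.
by move: h3; rewrite lee_pmul2l.
Qed.

(** The trivial bound CU for each piece makes the l^p sum CU * M ^ (1 / p), of
    smaller order than sqrt M. *)
Lemma no_lifting_gt2 : 2 < p -> False.
Proof.
move=> p2; pose C := 4 * (CS * CU) + 2.
have C0 : 0 < C by rewrite ltr_wpDl// mulr_ge0// mulr_ge0// ltW.
pose th := 2^-1 - p^-1.
have th0 : 0 < th by rewrite subr_gt0 ltf_pV2 ?posrE.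
pose M := (Num.bound (C `^ th^-1)).+1.
have M0 : (0 < M)%N by [].
have MR0 : 0 < M%:R :> R by rewrite ltr0n.
have M1 : 1 <= M%:R :> R by rewrite ler1n.
have mu00 : (mu set0 < +oo)%E by rewrite measure0.
have eta0 : 0 < M%:R^-1 :> R by rewrite invr_gt0.
have [n [B [y [P _]]]] := pieces_exist M eta0 measurable0 mu00.
pose Q := CU * M%:R `^ p^-1.
have MQ : 1 <= M%:R `^ p^-1.
  by rewrite -[leLHS](powRr0 M%:R) ler_powR// invr_ge0 ltW.
have CQ : CU <= Q by rewrite /Q ler_peMr// ltW.
have yQ : (\sum_(k < M) pint mu p (y k : L0) <= (Q `^ p)%:E)%E.
  rewrite /Q powRM ?(ltW CU0) ?powR_ge0// -powRrM mulVf ?gt_eqF// powRr1 ?ler0n//.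
  apply: (@le_trans _ _ (\sum_(k < M) (CU `^ p)%:E)%E).
    by apply: lee_sum => k _; exact: (pint_pieces P).
  by rewrite sumEFin sumr_const card_ord mulr_natr.
have := pieces_lower M0 P CQ yQ.
apply/negP; rewrite -ltNge.
apply: (@le_lt_trans _ _ (C * M%:R `^ p^-1)).
  by rewrite /C /Q mulrDl; lra.
have -> : Num.sqrt M%:R = M%:R `^ th * M%:R `^ p^-1.
  rewrite -powRD ?subrK ?powR12_sqrt ?ler0n//.
  by rewrite (gt_eqF MR0) implybT.
rewrite ltr_pM2r ?powR_gt0//.
have -> : C = (C `^ th^-1) `^ th by rewrite -powRrM mulVf ?gt_eqF// powRr1// ltW.
apply: gt0_ltr_powR => //; rewrite ?nnegrE ?powR_ge0 ?ler0n//.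
rewrite (lt_le_trans (archi_boundP (powR_ge0 _ _)))// ler_nat//.
Qed.

(** M is fixed first, so that sqrt M beats the bound of [pieces_lower] for l^p sums
    at most 1. Among N pieces, those with [pint] above 1 / M number at most
    M * O(N ^ (p / 2)), which leaves M others when N is large. *)
Lemma no_lifting_lt2 : p < 2 -> False.
Proof.
move=> p2; pose C := 4 * (CS * (CU + 1)) + 2.
have CU1 : 0 <= CU + 1 by rewrite addr_ge0// ltW.
have C0 : 0 < C by rewrite ltr_wpDl// mulr_ge0// mulr_ge0// ltW.
pose M := (Num.bound (C ^+ 2)).+1.
have MR0 : 0 < M%:R :> R by rewrite ltr0n.
have MC : C < Num.sqrt M%:R.
  rewrite -[C]ger0_norm ?(ltW C0)// -sqrtr_sqr ltr_sqrt//.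
  by rewrite (lt_le_trans (archi_boundP (sqr_ge0 C)))// ler_nat.
pose K := M%:R * (2 * CU `^ p).
have K0 : 0 < K by rewrite mulr_gt0// mulr_gt0// powR_gt0.
pose th := 1 - p / 2; have th0 : 0 < th by rewrite /th; lra.
pose N := ((Num.bound ((2 * K) `^ th^-1)) + 2 * M)%N.
have N0 : (0 < N)%N by rewrite (leq_trans _ (leq_addl _ _)) ?muln_gt0.
have NR0 : 0 < N%:R :> R by rewrite ltr0n.
have eta0 : 0 < M%:R^-1 :> R by rewrite invr_gt0.
have mu00 : (mu set0 < +oo)%E by rewrite measure0.
have [n [B [y [P _]]]] := pieces_exist N eta0 measurable0 mu00.
pose small k := (pint mu p (y k : L0) <= M%:R^-1%:E)%E.
pose s0 := [seq k <- iota 0 N | small k].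
have bigN : M%:R + K * Num.sqrt N%:R `^ p <= N%:R :> R.
  have -> : Num.sqrt N%:R `^ p = N%:R `^ (p / 2) :> R.
    by rewrite -powR12_sqrt ?ler0n// -powRrM mulrC.
  have NN : N%:R = N%:R `^ th * N%:R `^ (p / 2) :> R.
    rewrite -powRD ?subrK ?powRr1 ?ler0n//.
    by rewrite (gt_eqF NR0) implybT.
  have h1 : 2 * K <= N%:R `^ th.
    have -> : 2 * K = ((2 * K) `^ th^-1) `^ th.
      by rewrite -powRrM mulVf ?gt_eqF// powRr1// mulr_ge0// ltW.
    apply: ge0_ler_powR; rewrite ?nnegrE ?powR_ge0 ?ler0n ?(ltW th0)//.
    rewrite (le_trans (ltW (archi_boundP (powR_ge0 _ _))))// ler_nat leq_addr//.
  have h2 : 2 * (K * N%:R `^ (p / 2)) <= N%:R.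
    by rewrite [leRHS]NN mulrA ler_wpM2r ?powR_ge0.
  have h3 : 2 * M%:R <= N%:R :> R by rewrite -natrM ler_nat leq_addl.
  lra.
have cnt : (M <= size s0)%N.
  have av := pieces_average (ltW p2) N0 P.
  have : (((count (predC small) (iota 0 N))%:R / M%:R)%:E <=
      (2 * CU `^ p * Num.sqrt N%:R `^ p)%:E)%E.
    apply: le_trans av.
    rewrite -(big_mkord xpredT (fun k => pint mu p (y k : L0))) /index_iota subn0.
    elim: (iota 0 N) => [|k l IH]; first by rewrite big_nil mul0r.
    rewrite big_cons /= natrD mulrDl EFinD leeD//.
    case: (boolP (small k)) => h /=.
      by rewrite mul0r pint_ge0.
    by rewrite mul1r ltW// ltNge.
  rewrite lee_fin ler_pdivrMr// => h.
  have := count_predC small (iota 0 N); rewrite size_iota -size_filter -/s0 => e.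
  rewrite -(ler_nat R).
  have eR : (size s0)%:R + (count (predC small) (iota 0 N))%:R = N%:R :> R.
    by rewrite -natrD e.
  have -> : (size s0)%:R = N%:R - (count (predC small) (iota 0 N))%:R :> R.
    by rewrite -eR addrK.
  rewrite lerBrDr; apply: le_trans bigN; rewrite lerD2l (le_trans h)// /K.
  by rewrite le_eqVlt; apply/orP; left; apply/eqP; ring.
pose s := take M s0.
have sM : size s = M by rewrite size_takel.
have us : uniq s by rewrite take_uniq// filter_uniq// iota_uniq.
have ss0 : {subset s <= s0} by move=> k; exact: mem_take.
have sN : all (fun k => k < N)%N s.
  by apply/allP => k /ss0; rewrite mem_filter mem_iota add0n => /andP[].
have P' := pieces_nth us sN P; rewrite sM in P'.
have Q1 : CU <= CU + 1 by rewrite lerDl.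
have yQ : (\sum_(k < M) pint mu p (y (nth 0%N s k) : L0) <= ((CU + 1) `^ p)%:E)%E.
  apply: (@le_trans _ _ 1%E); last first.
    by rewrite lee_fin -[leLHS](powRr0 (CU + 1)) ler_powR ?(ltW p0)// lerDr ltW.
  apply: (@le_trans _ _ (\sum_(k < M) (M%:R^-1)%:E)%E).
    apply: lee_sum => k _.
    have /ss0 : nth 0%N s k \in s by rewrite mem_nth// sM.
    by rewrite mem_filter => /andP[].
  by rewrite sumEFin sumr_const card_ord -[X in X%:E]mulr_natr mulVf ?gt_eqF.
have := pieces_lower (ltn0Sn _) P' Q1 yQ.
by apply/negP; rewrite -ltNge.
Qed.

End lifting.

(** * Complemented copies *)

Section complemented_copies.
Local Open Scope classical_set_scope.
Local Open Scope ring_scope.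
Context (R : realType).

(** Homogeneity is only asked on [Y], as the inverse of an isomorphism onto a
    subspace is arbitrary elsewhere. *)
Lemma bounded_of_near0 (A B : normedModType R) (Y : set A) (f : A -> B) (e : R) :
  0 < e -> (forall a y, Y y -> Y (a *: y)) ->
  (forall a y, Y y -> f (a *: y) = a *: f y) ->
  (forall y, Y y -> `|y| < e -> `|f y| <= 1) ->
  forall y, Y y -> `|f y| <= 2 / e * `|y|.
Proof.
move=> e0 YZ fZ fe y Yy.
have [y0|y0] := eqVneq y 0.
  by rewrite y0 -[X in f X](scale0r y) fZ// scale0r !normr0 mulr0.
have ny : 0 < `|y| by rewrite normr_gt0.
pose a := e / (2 * `|y|); have a0 : 0 < a by rewrite divr_gt0// mulr_gt0.
have := fe _ (YZ a _ Yy); rewrite fZ// normrZ [`|a *: f y|]normrZ gtr0_norm// => h.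
have : a * `|f y| <= 1.
  apply: h; rewrite (_ : a * `|y| = e / 2); last first.
    by rewrite /a; field; rewrite gt_eqF.
  by rewrite ltr_pdivrMr// ltr_pMr// ltr1n.
rewrite -ler_pdivlMl// mulr1 => /le_trans; apply.
by rewrite /a invf_div mulrAC.
Qed.

(** S is the inverse isomorphism after the projection: it is linear because it only
    uses the inverse on the range of the projection. *)
Lemma factorization_of_complemented_copy (X W : normedModType R) :
  contains_complemented_copy X W ->
  exists (U : {linear W -> X}) (S : {linear X -> W}) (CU CS : R),
  [/\ 0 < CU, 0 < CS, forall f, `|U f| <= CU * `|f|,
      forall x, `|S x| <= CS * `|x| & forall f, S (U f) = f].
Proof.
move=> [Y [[_ [P [Pid [C PC]] PY]] [U [V [Uc UY UV Vc]]]]].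
have YZ a y : Y y -> Y (a *: y).
  by rewrite -UY => -[z _ <-]; exists (a *: z) => //; rewrite linearZ.
have YD y y' : Y y -> Y y' -> Y (y + y').
  by rewrite -UY => -[z _ <-] [z' _ <-]; exists (z + z') => //; rewrite linearD.
have VZ a y : Y y -> V (a *: y) = a *: V y.
  by rewrite -UY => -[z _ <-]; rewrite -linearZ !UV.
have VD y y' : Y y -> Y y' -> V (y + y') = V y + V y'.
  by rewrite -UY => -[z _ <-] [z' _ <-]; rewrite -linearD !UV.
have YP x : Y (P x) by rewrite -PY; exists x.
have Y0 : Y 0 by rewrite -(linear0 P).
pose S x := V (P x).
have S_lin : linear S.
  by move=> a x y; rewrite /S linearP VD ?VZ//; exact: YZ.
pose SL : {linear X -> W} := HB.pack S (GRing.isLinear.Build R X W *:%R S S_lin).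
have SU f : SL (U f) = f.
  have YU : Y (U f) by rewrite -UY; exists f.
  have [x _ xU] : range P (U f) by rewrite PY.
  by rewrite /= /S -xU; have /= -> := Pid x; rewrite xU UV.
have [CU CU0 UC] : exists2 CU, 0 < CU & forall f, `|U f| <= CU * `|f|.
  have : \forall z \near (0 : W), `|U z| < 1.
    have : U z @[z --> (0 : W)] --> U 0 by exact: Uc.
    rewrite linear0 => /cvgrPdist_lt /(_ 1 ltr01).
    by apply: filterS => z; rewrite sub0r normrN.
  move=> /nbhs_normP[e /= e0 He].
  exists (2 / e); first by rewrite divr_gt0.
  move=> f; apply: (@bounded_of_near0 _ _ setT) => //.
    by move=> a y _; rewrite linearZ.
  by move=> y _ ye; apply/ltW/He; rewrite /ball_ /= sub0r normrN.
have [CV CV0 VC] : exists2 CV, 0 < CV & forall y, Y y -> `|V y| <= CV * `|y|.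
  have : \forall y \near within Y (nbhs (0 : X)), `|V y| < 1.
    have V0 : V 0 = 0 by rewrite -(scale0r 0) VZ// scale0r.
    have : V @ within Y (nbhs 0) --> V 0.
      by have := Vc 0; rewrite /continuous_at /nbhs/= -nbhs_subspace_in.
    rewrite V0 => /cvgrPdist_lt /(_ 1 ltr01).
    by apply: filterS => z; rewrite sub0r normrN.
  move=> /nbhs_normP[e /= e0 He].
  exists (2 / e); first by rewrite divr_gt0.
  apply: bounded_of_near0 => //.
  by move=> y Yy ye; apply/ltW/He => //; rewrite /ball_ /= sub0r normrN.
have C1 : 0 < `|C| + 1 by rewrite ltr_wpDl.
have SLC x : `|SL x| <= CV * (`|C| + 1) * `|x|.
  rewrite -mulrA (le_trans (VC _ (YP x)))// ler_pM2l// (le_trans (PC x))//.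
  by rewrite ler_wpM2r// (le_trans (ler_norm C))// lerDl.
exists U, SL, CU, (CV * (`|C| + 1)); split => //; exact: mulr_gt0.
Qed.

End complemented_copies.

Section conclusion.
Local Open Scope classical_set_scope.
Local Open Scope ring_scope.
Context d (T : measurableType d) (R : realType).
Variables (mu : {measure set T -> \bar R}) (p : R) (p1 : (1 <= p%:E)%E).
Variables (D : set T) (r : nat -> T -> R).

(** All that matters of the measure space is a set of measure 1 that carries a
    sequence of functions of modulus 1 with Bessel's inequality for their finite
    combinations, for instance an orthonormal one. *)
Theorem no_complemented_copy :
  measurable D -> mu D = 1%E -> (forall n, measurable_fun setT (r n)) ->
  (forall n t, D t -> `|r n t| = 1) -> (forall n t, ~ D t -> r n t = 0) ->
  (forall N (a : nat -> R),
    (\int[mu]_(t in D) ((\sum_(n < N) a n * r n t) ^+ 2)%:E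
     <= (\sum_(n < N) a n ^+ 2)%:E)%E) ->
  p != 2 ->
  ~ contains_complemented_copy (LcapLinfty mu p1) (LspaceType mu p1).
Proof.
move=> mD muD mr r1 r0 orth p2 copy.
have [U [S [CU [CS [CU0 CS0 UC SC SU]]]]] := factorization_of_complemented_copy copy.
have mu0 : (0 < mu setT)%E.
  by rewrite (lt_le_trans (_ : (0 < mu D)%E))// ?muD// -muD le_measure// inE.
have pp : 0 < p by rewrite (lt_le_trans ltr01)// -lee_fin.
have ry n : (pint mu p (r n) < +oo)%E.
  rewrite /pint (@integral_restrT _ _ _ mu D).
  - apply: (@le_lt_trans _ _ (\int[mu]_(t in D) (cst 1 t)%:E)%E).
      apply: le_integral_real => //; first exact: measurable_normp.
      by move=> t Dt; rewrite r1// powR1 /= ler01 lexx.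
    by rewrite (integral_cst mu mD 1) muD mule1 ltry.
  - exact: measurable_normp.
  - by move=> t Dt; rewrite r0// normr0 powR0// gt_eqF.
have /choice [rad radE] n := Lspace_exists p1 (mr n) (ry n).
have [lt2|gt2|e2] := ltgtP p 2.
- exact: (no_lifting_lt2 mu0 mD muD mr r1 r0 orth radE CU0 CS0 UC SC SU lt2).
- exact: (no_lifting_gt2 mu0 mD muD mr r1 r0 orth radE CU0 CS0 UC SC SU gt2).
- by rewrite e2 eqxx in p2.
Qed.

End conclusion.

(** * Rademacher functions *)

(** Splits each dyadic interval into its two halves. *)
Lemma sum_doubled (V : nmodType) K (f : nat -> V) :
  \sum_(j < K.*2) f j = \sum_(i < K) (f i.*2 + f i.*2.+1).
Proof.
elim: K => [|K IH]; first by rewrite !big_ord0.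
by rewrite doubleS !big_ord_recr /= IH addrA.
Qed.

(** [tau m t] is the index, among the 2 ^ m intervals of level m, of the one that
    contains t. *)
Section dyadic.
Local Open Scope classical_set_scope.
Local Open Scope ring_scope.
Context d (T : measurableType d) (R : realType).
Variables (mu : {measure set T -> \bar R}) (D : set T) (tau : nat -> T -> nat).
Let cell m j := D `&` [set t | tau m t = j].
Hypothesis mcell : forall m j, measurable (cell m j).
Hypothesis mucell : forall m j, (j < 2 ^ m)%N -> mu (cell m j) = (2 ^- m)%:E.
Hypothesis tau_lt : forall m t, D t -> (tau m t < 2 ^ m)%N.
Hypothesis tau_half : forall m t, D t -> tau m t = (tau m.+1 t)./2.

Definition dyadic_step m (F : nat -> R) (t : T) : R :=
  \sum_(j < 2 ^ m) F j * \1_(cell m j) t.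

Lemma dyadic_stepE m F t : D t -> dyadic_step m F t = F (tau m t).
Proof.
move=> Dt; rewrite /dyadic_step (bigD1 (Ordinal (tau_lt m Dt)))//=.
rewrite indicE mem_set// mulr1 big1 ?addr0// => j jt.
rewrite indicE memNset ?mulr0// => -[_ /= tj]; move: jt; apply/negP.
by rewrite negbK; apply/eqP/val_inj.
Qed.

Lemma dyadic_step_out m F t : ~ D t -> dyadic_step m F t = 0.
Proof.
by move=> Dt; apply: big1 => j _; rewrite indicE memNset ?mulr0// => -[].
Qed.

Lemma measurable_dyadic_step m F : measurable_fun setT (dyadic_step m F).
Proof.
by apply: measurable_sum => j; apply: measurable_funM => //; exact: measurable_indic.
Qed.

Lemma dyadic_domainE : D = cell 0 0.
Proof.
apply/seteqP; split=> [t Dt|t []//]; split => //=.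
by apply/eqP; rewrite -leqn0 -ltnS; exact: tau_lt.
Qed.

Lemma measurable_dyadic_domain : measurable D.
Proof. by rewrite dyadic_domainE. Qed.

Lemma dyadic_domain_measure : mu D = 1%E.
Proof. by rewrite dyadic_domainE mucell// expr0 invr1. Qed.

Let mD := measurable_dyadic_domain.

Lemma integral_dyadic_step m F : (forall j, 0 <= F j) ->
  (\int[mu]_(t in D) (dyadic_step m F t)%:E = (2 ^- m * \sum_(j < 2 ^ m) F j)%:E)%E.
Proof.
move=> F0; rewrite /dyadic_step integral_real_sum//; last 2 first.
- by move=> j; apply: measurable_funM => //; exact: measurable_indic.
- by move=> j t _; rewrite mulr_ge0// indicE.
rewrite mulr_sumr -sumEFin; apply: eq_bigr => j _.
rewrite integral_realZ//.
rewrite integral_indic// setIidl; last by move=> t [].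
by rewrite mucell// -EFinM mulrC.
Qed.

Definition rademacher n := dyadic_step n.+1 (fun j => (-1) ^+ j).

(** The sum of the a n * r_n, n < N, as a function of the index of the interval of level
    N: halving the index passes to the coarser level. *)
Fixpoint rad_digits (a : nat -> R) N j : R :=
  if N is N'.+1 then rad_digits a N' j./2 + a N' * (-1) ^+ j else 0.

Lemma sum_rademacherE (a : nat -> R) N t : D t ->
  \sum_(n < N) a n * rademacher n t = rad_digits a N (tau N t).
Proof.
move=> Dt; elim: N => [|N IH]; first by rewrite big_ord0.
by rewrite big_ord_recr /= IH tau_half// /rademacher dyadic_stepE.
Qed.

Lemma sum_rad_digits (a : nat -> R) N :
  \sum_(j < 2 ^ N) rad_digits a N j ^+ 2 = 2 ^+ N * \sum_(n < N) a n ^+ 2.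
Proof.
elim: N => [|N IH].
  by rewrite big_ord0 mulr0 big1// => j _; rewrite expr0n.
rewrite expnS mul2n (sum_doubled _ (fun j => rad_digits a N.+1 j ^+ 2)).
rewrite big_ord_recr /= exprS.
have E (i : 'I_(2 ^ N)) :
    (rad_digits a N i.*2./2 + a N * (-1) ^+ i.*2) ^+ 2 +
    (rad_digits a N i.*2.+1./2 + a N * (-1) ^+ i.*2.+1) ^+ 2 =
    2 * rad_digits a N i ^+ 2 + 2 * a N ^+ 2.
  rewrite doubleK -[i.*2.+1./2]/(uphalf i.*2) uphalf_double.
  rewrite -[(-1) ^+ i.*2]signr_odd -[(-1) ^+ i.*2.+1]signr_odd /= odd_double /=.
  by rewrite expr0 expr1; ring.
under eq_bigr do rewrite E.
rewrite big_split /= -mulr_sumr IH sumr_const card_ord -[X in _ + X]mulr_natl natrX.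
by ring.
Qed.

Lemma rademacher_norm n t : D t -> `|rademacher n t| = 1.
Proof.
by move=> Dt; rewrite /rademacher dyadic_stepE// normrX normrN1 expr1n.
Qed.

Lemma rademacher_orthonormal N (a : nat -> R) :
  (\int[mu]_(t in D) ((\sum_(n < N) a n * rademacher n t) ^+ 2)%:E
   = (\sum_(n < N) a n ^+ 2)%:E)%E.
Proof.
transitivity (\int[mu]_(t in D)
    (dyadic_step N (fun j => rad_digits a N j ^+ 2) t)%:E)%E.
  by apply: eq_integral => t /set_mem Dt; rewrite sum_rademacherE// dyadic_stepE.
rewrite integral_dyadic_step; last by move=> j; exact: sqr_ge0.
by rewrite sum_rad_digits mulKf// expf_neq0.
Qed.

End dyadic.

Section half_line_dyadic.
Local Open Scope classical_set_scope.
Local Open Scope ring_scope.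
Variable R : realType.
Local Notation mu := (half_line_measure R).
Local Notation T := (caratheodory_type (wlength (@idfun R))^*%mu).

Definition unit_interval : set T := (`[0, 1[%classic : set R).
Definition digits (m : nat) (t : T) : nat := Num.truncn (2 ^+ m * (t : R)).

Lemma measurable_co (a b : R) : measurable (`[a, b[%classic : set T).
Proof. by apply: sub_caratheodory; exact: (measurable_itv `[a, b[). Qed.

Lemma half_line_co (a b : R) : 0 <= a -> a <= b ->
  mu (`[a, b[%classic : set R) = (b - a)%:E.
Proof.
move=> a0 ab; rewrite /half_line_measure /mrestr.
(* Both measures are restrictions of the same outer measure. *)
have -> : completed_lebesgue_measure (`[a, b[%classic `&` `]0, +oo[%classic : set R) =
  lebesgue_measure (`[a, b[%classic `&` `]0, +oo[%classic : set R) by [].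
have [e|aN] := eqVneq a 0.
  rewrite e in ab *.
  rewrite (_ : _ `&` _ = `]0, b[%classic); last first.
    apply/seteqP; split=> t /=; rewrite !in_itv /= ?andbT.
      by move=> [/andP[_ ->] ->].
    by move=> /andP[t0 ->]; rewrite t0 ltW.
  rewrite lebesgue_measure_itv /= lte_fin; case: ltP => // b0.
  by rewrite subr0; congr (_%:E); apply: le_anti; rewrite ab b0.
have a0' : 0 < a by rewrite lt_neqAle eq_sym aN.
rewrite (_ : _ `&` _ = `[a, b[%classic); last first.
  apply/seteqP; split=> t /=; rewrite !in_itv /= ?andbT; first by move=> [].
  by move=> /andP[at_ ->]; rewrite at_ (lt_le_trans a0').
rewrite lebesgue_measure_itv /= lte_fin; case: ltP => // ba.
by rewrite (_ : b = a) ?subrr//; apply/eqP; rewrite eq_le ba ab.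
Qed.

Lemma digits_cell m j : (j < 2 ^ m)%N ->
  unit_interval `&` [set t | digits m t = j] =
  (`[j%:R / 2 ^+ m, j.+1%:R / 2 ^+ m[%classic : set R).
Proof.
move=> jm; have m0 : 0 < 2 ^+ m :> R by rewrite exprn_gt0.
apply/seteqP; split=> t /=.
  rewrite /unit_interval /digits /= !in_itv /= => -[/andP[t0 t1] <-].
  rewrite ler_pdivrMr// ltr_pdivlMr// [(t : R) * _]mulrC.
  by apply: truncn_itv; rewrite mulr_ge0// ltW.
rewrite in_itv /= ler_pdivrMr// ltr_pdivlMr// => /andP[h1 h2].
split; last by apply: truncn_def; rewrite mulrC h1.
rewrite /unit_interval /= in_itv /=; apply/andP; split.
  by rewrite -(pmulr_lge0 _ m0) (le_trans _ h1).
rewrite -(ltr_pM2r m0) mul1r (lt_le_trans h2)// -natrX ler_nat//.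
Qed.

Lemma digits_lt m t : unit_interval t -> (digits m t < 2 ^ m)%N.
Proof.
rewrite /unit_interval /digits /= in_itv /= => /andP[t0 t1].
rewrite truncn_lt_nat; last by rewrite mulr_ge0// exprn_ge0.
by rewrite natrX gtr_pMr// exprn_gt0.
Qed.

Lemma measurable_digits m j :
  measurable (unit_interval `&` [set t | digits m t = j]).
Proof.
have [jm|mj] := ltnP j (2 ^ m); first by rewrite digits_cell//; exact: measurable_co.
rewrite (_ : _ `&` _ = set0); first exact: measurable0.
apply/seteqP; split=> // t [Dt /= tj].
by have := digits_lt m Dt; rewrite tj ltnNge mj.
Qed.

Lemma measure_digits m j : (j < 2 ^ m)%N ->
  mu (unit_interval `&` [set t | digits m t = j]) = (2 ^- m)%:E.
Proof.
move=> jm; have m0 : 0 < 2 ^+ m :> R by rewrite exprn_gt0.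
rewrite digits_cell// half_line_co.
- by rewrite -mulrBl -natr1 addrAC subrr add0r mul1r.
- by rewrite divr_ge0// ltW.
- by rewrite ler_pM2r ?invr_gt0// ler_nat.
Qed.

Lemma digits_half m t : unit_interval t -> digits m t = (digits m.+1 t)./2.
Proof.
rewrite /unit_interval /digits /= in_itv /= => /andP[t0 _].
set x := 2 ^+ m * (t : R); have x0 : 0 <= x by rewrite mulr_ge0// exprn_ge0.
have -> : 2 ^+ m.+1 * (t : R) = 2 * x by rewrite exprS mulrA.
have /truncn_itv/andP[] : 0 <= 2 * x by rewrite mulr_ge0.
set k := Num.truncn (2 * x) => h1 h2.
apply: truncn_def.
have ek := odd_double_half k.
have ekR : k%:R = (odd k)%:R + 2 * (k./2)%:R :> R.
  by rewrite -[in LHS]ek natrD -mul2n natrM.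
have o1 : (odd k)%:R <= 1 :> R by rewrite lern1; case: (odd k).
have o0 : 0 <= (odd k)%:R :> R by [].
rewrite -natr1 in h2; rewrite ekR in h1 h2; rewrite -natr1.
apply/andP; split; first by lra.
have [hx|//] := leP ((k./2)%:R + 1) x.
have : ((k./2).+1.*2)%:R <= 2 * x :> R.
  by rewrite -mul2n natrM -natr1; lra.
move=> h3; exfalso.
have : ((k./2).+1.*2 <= k)%N by rewrite truncn_ge_nat// mulr_ge0.
by rewrite -geq_half_double ltnn.
Qed.

End half_line_dyadic.

(** * The half-line *)

Theorem mainTheorem2 (R : realType) (p : R) (p1 : (1 <= p%:E)%E)
    (p2 : p != 2) :
  ~ contains_complemented_copy
      (LcapLinfty (half_line_measure R) p1)
      (LspaceType (half_line_measure R) p1).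
Proof.
have mcell := @measurable_digits R; have lt_tau := @digits_lt R.
apply: (@no_complemented_copy _ _ R _ p p1 (@unit_interval R)
  (rademacher R (@unit_interval R) (@digits R))) => //.
- exact: measurable_dyadic_domain mcell lt_tau.
- exact: dyadic_domain_measure (@measure_digits R) lt_tau.
- by move=> n; exact: measurable_dyadic_step.
- by move=> n t; exact: rademacher_norm lt_tau n t.
- by move=> n t; exact: dyadic_step_out.
- move=> N a; rewrite (rademacher_orthonormal mcell (@measure_digits R) lt_tau)//.
  exact: digits_half.
Qed.
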